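(* Suppose we are given: - a matrix $A \in \mathbb{R}^{n_A \times m}$ and parameters $\Delta = (\Delta_1,\ldots,\Delta_{n_A}) > \mathbf{0}$ such that $H_{\Delta}(A^J) \leq \frac{|J|}{10}$ for every $J \subseteq \{1,\ldots,m\}$; - a matrix $B \in [-1,1]^{n_B\times m}$ with weights $\mu_1,\ldots,\mu_{n_B} > 0$ satisfying $\sum_{i=1}^{n_B}\mu_i \leq 1$; - a vector $x \in [0,1]^m$ and an objective function $c \in [-1,1]^m$. Let $n := n_A + n_B$. Then there is a random variable $y \in \{0,1\}^m$ with the following properties. - Preserved expectation: $E[c^Ty] = c^Tx$, $E[Ay] = Ax$ and $E[By] = Bx$. - Bounded difference: $|c^Tx - c^Ty| \leq O(1)$. For all $i=1,\ldots,n_A$, $|A_ix - A_iy| \leq \log(\min\{4n,4m\})\cdot \Delta_i$. For all $i = 1,\ldots,n_B$, $|B_ix - B_iy| \leq O(\sqrt{1/\mu_i})$. - Tail bounds: for all $i=1,\ldots,n_A$ and all $\lambda \geq 0$, $\Pr[|A_ix - A_iy| \geq \lambda\cdot\sqrt{\log(\min\{4n,4m\})}\cdot\Delta_i] \leq 2e^{-\lambda^2/2}$.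
   Context: Entropy: for a discrete random variable $Z$, $H(Z) = \sum_z \Pr[Z=z]\log_2(1/\Pr[Z=z])$. For a function $f$, $H_{\chi\in\{\pm1\}^m} f(\chi)$ denotes the entropy of $f(\chi)$ when $\chi$ is uniformly random in $\{\pm 1\}^m$. $\Delta$-approximate entropy: for $A\in\mathbb{R}^{n\times m}$ with rows $A_1,\ldots,A_n$ and $\Delta=(\Delta_1,\ldots,\Delta_n)$ with all $\Delta_i>0$, $$H_\Delta(A) := \min\Big\{ H_{\chi\in\{\pm1\}^m}\big(f_1(\chi),\ldots,f_n(\chi)\big) : f_1,\ldots,f_n:\{\pm1\}^m\to\mathbb{R},\ |A_i\chi - f_i(\chi)|\leq \Delta_i\ \forall i,\ \forall \chi\in\{\pm1\}^m\Big\}.$$ $A^J$ denotes the submatrix of $A$ consisting of the columns indexed by $J$. $A_i$ and $B_i$ denote the $i$-th rows. $\log$ is to base $2$, and $O(\cdot)$ hides absolute constants. *)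

(* Defs.v *)
From HB Require Import structures.
From mathcomp Require Export all_boot all_order all_algebra.
From mathcomp Require Export all_classical all_reals all_analysis.
Export Order.TTheory GRing.Theory Num.Theory.
Export numFieldNormedType.Exports.

Set Implicit Arguments.
Unset Strict Implicit.
Unset Printing Implicit Defensive.

Local Open Scope classical_set_scope.
Local Open Scope ring_scope.

Definition log2 (R : realType) (x : R) : R := ln x / ln 2.

Definition unif_prob (R : realType) (T : finType) (E : pred T) : R :=
  #|E|%:R / #|T|%:R.

(* Entropy of f(t) for t uniform in T; only the values taken by f contribute,
   so the sum ranges over the image of f, each value listed once. *)
Definition entropy (R : realType) (T : finType) (Z : eqType) (f : T -> Z) : R :=
  \sum_(z <- undup (codom f))
    let p : R := unif_prob R [pred t | f t == z] in p * log2 (1 / p).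

(* {-1, 1}^m, an element being encoded by the set of its -1 coordinates. *)
Definition sign_cube (m : nat) : finType := {ffun 'I_m -> bool}.

Definition signs (R : realType) (m : nat) (chi : sign_cube m) : 'cV[R]_m :=
  \col_j (-1) ^+ chi j.

Definition approximates (R : realType) (n m : nat) (Delta : 'I_n -> R)
    (A : 'M[R]_(n, m)) (f : sign_cube m -> 'cV[R]_n) : Prop :=
  forall (i : 'I_n) (chi : sign_cube m),
    `|(A *m signs R chi) i 0 - f chi i 0| <= Delta i.

(* The infimum is a minimum: see approx_entropy_min. *)
Definition approx_entropy (R : realType) (n m : nat) (Delta : 'I_n -> R)
    (A : 'M[R]_(n, m)) : R :=
  inf [set entropy R f | f in [set f | approximates Delta A f]].

Definition col_submx (R : realType) (n m : nat) (A : 'M[R]_(n, m))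
    (J : {set 'I_m}) : 'M[R]_(n, #|J|) :=
  colsub (fun k : 'I_#|J| => enum_val k) A.

Definition bool_vec (R : realType) (m : nat) (b : 'I_m -> bool) : 'cV[R]_m :=
  \col_j (b j)%:R.

Lemma entropyE (R : realType) (T : finType) (Z : eqType) (f : T -> Z) :
  entropy R f = #|T|%:R^-1 *
    \sum_t log2 (1 / unif_prob R [pred t' | f t' == f t]).
Proof.
rewrite /entropy /= mulr_sumr.
transitivity (\sum_(z <- undup (codom f)) \sum_(t | f t == z)
    #|T|%:R^-1 * log2 (1 / unif_prob R [pred t' | f t' == z])).
  apply: eq_bigr => z _.
  by rewrite sumr_const -[RHS]mulr_natl mulrA.
under eq_bigr do rewrite big_mkcond.
rewrite exchange_big /=; apply: eq_bigr => t _.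
rewrite (bigD1_seq (f t)) ?undup_uniq ?mem_undup ?codom_f //= eqxx.
by rewrite big1 ?addr0 // => z; rewrite eq_sym => /negbTE ->.
Qed.

Lemma approx_entropy_min (R : realType) (n m : nat) (Delta : 'I_n -> R)
    (A : 'M[R]_(n, m)) :
  (forall i, 0 < Delta i) ->
  (exists f, approximates Delta A f /\ entropy R f = approx_entropy Delta A) /\
  (forall f, approximates Delta A f -> approx_entropy Delta A <= entropy R f).
Proof.
move=> Delta0.
pose K := {ffun sign_cube m -> {ffun sign_cube m -> bool}}.
pose ker (f : sign_cube m -> 'cV[R]_n) : K :=
  [ffun t => [ffun t' => f t' == f t]].
pose H (k : K) : R := #|sign_cube m|%:R^-1 *
  \sum_t log2 (1 / unif_prob R [pred t' | k t t']).
have HE f : entropy R f = H (ker f).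
  rewrite entropyE; congr (_ * _); apply: eq_bigr => t _.
  congr (log2 (1 / (_%:R / _))); apply: eq_card => t'.
  by rewrite !inE !ffunE.
pose P k := `[< exists2 f, approximates Delta A f & ker f = k >].
have P0 : P (ker (fun chi => A *m signs R chi)).
  apply/asboolP; exists (fun chi => A *m signs R chi) => // i chi.
  by rewrite subrr normr0 ltW.
have [k /asboolP[f ff fk] kmin] := @arg_minP _ _ _ _ P H P0.
have fmin g : approximates Delta A g -> entropy R f <= entropy R g.
  by move=> gg; rewrite !HE fk; apply: kmin; apply/asboolP; exists g.
suff fE : entropy R f = approx_entropy Delta A.
  by split; [exists f | rewrite -fE].
apply/eqP; rewrite eq_le; apply/andP; split.
  by apply: lb_le_inf; [exists (entropy R f); exists f|move=> _ [g gg <-]; exact: fmin].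
by apply: ge_inf; [exists (entropy R f) => _ [g gg <-]; exact: fmin | exists f].
Qed.

(* Main.v *)
From HB Require Import structures.
Require Import Defs.
From mathcomp Require Import measurable_realfun.
From mathcomp Require Import ring lra zify.

(**
Beck's entropy method, as in Rothvoss' entropy rounding.  On a set J of s
columns, round each signed sum of a row of B to a grid of suitable width.  The
rounded values together with functions attaining the approximate entropy of A
have joint entropy at most s/10 + s/15, so some fiber of the joint function has
at least 2^(5s/6) points of the sign cube.  A set that large contains two points
differing in more than s/2 places, and half their difference is a partial
coloring with small discrepancy.  The joint entropy is bounded by a cross
entropy (Gibbs), with a geometric prior for each rounded row, so that only
second and fourth moments of Rademacher sums enter.

Moving x to a vertex, all but min(m, n+1) coordinates become integral.  The
remaining ones are first rounded at random to multiples of 2^(-K); then the bits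
are eliminated one at a time, the least significant first, adding at bit k a
random sign times 2^(-k) times a partial coloring of the coordinates whose bit
is set.  As more than half of the active coordinates are colored each time,
log2(s+1) steps suffice per bit, which is smaller than log2(min(4n,4m)) by an
absolute constant; this leaves room for the initial rounding.  The random moves
have mean zero and the exponential moments multiply, whence the tail bound.
*)

Set Implicit Arguments.
Unset Strict Implicit.
Unset Printing Implicit Defensive.

Local Open Scope classical_set_scope.
Local Open Scope ring_scope.

(** * Distant points in large subsets of the cube *)

Definition cube_cons s (b : bool) (x : {ffun 'I_s -> bool}) :
    {ffun 'I_s.+1 -> bool} :=
  [ffun i => if unlift ord0 i is Some j then x j else b].

Lemma cube_cons0 s b (x : {ffun 'I_s -> bool}) : cube_cons b x ord0 = b.
Proof. by rewrite ffunE unlift_none. Qed.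

Lemma cube_consS s b (x : {ffun 'I_s -> bool}) j :
  cube_cons b x (lift ord0 j) = x j.
Proof. by rewrite ffunE liftK. Qed.

Lemma big_cube (V : nmodType) s (F : {ffun 'I_s.+1 -> bool} -> V) :
  \sum_x F x = \sum_x F (cube_cons false x) + \sum_x F (cube_cons true x).
Proof.
rewrite (reindex (fun p : bool * {ffun 'I_s -> bool} => cube_cons p.1 p.2)).
  rewrite -(pair_bigA _ (fun b x => F (cube_cons b x))) /=.
  by rewrite big_bool addrC.
exists (fun x : {ffun 'I_s.+1 -> bool} =>
    (x ord0, [ffun j : 'I_s => x (lift ord0 j)])) => [[b x] _|x _] /=.
  rewrite cube_cons0; congr pair; apply/ffunP => j.
  by rewrite ffunE cube_consS.
by apply/ffunP => i; rewrite ffunE; case: unliftP => [j|] ->; rewrite ?ffunE.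
Qed.

Lemma big_cube0 (V : nmodType) (F : {ffun 'I_0 -> bool} -> V) x :
  \sum_y F y = F x.
Proof.
by rewrite (bigD1 x) //= big1 ?addr0 // => y /eqP[]; apply/ffunP => - [].
Qed.

Definition hamming s (x y : {ffun 'I_s -> bool}) : nat := \sum_i (x i != y i).

Lemma hamming_cons s a b (x y : {ffun 'I_s -> bool}) :
  hamming (cube_cons a x) (cube_cons b y) = ((a != b) + hamming x y)%N.
Proof.
rewrite /hamming big_ord_recl !cube_cons0; congr addn.
by apply: eq_bigr => i _; rewrite !cube_consS.
Qed.

Section TwoFunctions.
Variable R : realFieldType.

(** For [p] between [c] and [4 * c], the convex function [p + c ^ 2 / p] is largest at [p = 4 * c],
    where it equals [17 / 4 * c]; the factored product in the proof expresses this. *)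
Lemma addr_le_of_mul (p r c : R) : 0 <= p -> 0 <= r -> p <= 4 * c ->
  r <= 4 * c -> p * r <= c * c -> p + r <= 17 / 4 * c.
Proof.
wlog rp : p r / r <= p.
  move=> H; have [rp|/ltW pr] := lerP r p; first exact: H.
  by move=> *; rewrite addrC; apply: H; rewrite // mulrC.
move=> p0 r0 p4 r4 pr; have [pc|cp] := lerP p c; first by lra.
have p1 : 0 < p by lra.
rewrite -(ler_pM2l p1).
have : 0 <= (4 * c - p) * (p - c / 4) by rewrite mulr_ge0 //; lra.
by lra.
Qed.

(** The diagonal products give [2 * c], the crossed ones [17 / 4 * c]. Equality holds for
    [f = (2, 1/2)], [g = (1/2, 2)], [c = 1]. *)
Lemma two_function_base (f0 f1 g0 g1 c : R) :
  0 <= f0 -> 0 <= f1 -> 0 <= g0 -> 0 <= g1 ->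
  f0 * g0 <= c -> f1 * g1 <= c -> f0 * g1 <= 4 * c -> f1 * g0 <= 4 * c ->
  (f0 + f1) * (g0 + g1) <= 25 / 4 * c.
Proof.
move=> f00 f10 g00 g10 h00 h11 h01 h10.
suff : f0 * g1 + f1 * g0 <= 17 / 4 * c by rewrite mulrDl !mulrDr; lra.
apply: addr_le_of_mul; rewrite ?mulr_ge0 //.
rewrite (_ : _ * _ = (f0 * g0) * (f1 * g1)); last by ring.
by apply: ler_pM; rewrite ?mulr_ge0.
Qed.

(** The constant tensorizes: splitting off one coordinate, the four pairs of half-cubes satisfy the
    hypothesis with [c] or [4 * c], and [two_function_base] combines them. *)
Lemma two_function s (f g : {ffun 'I_s -> bool} -> R) (c : R) : 0 <= c ->
  (forall x, 0 <= f x) -> (forall x, 0 <= g x) ->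
  (forall x y, f x * g y <= 4 ^+ hamming x y * c) ->
  (\sum_x f x) * (\sum_x g x) <= (25 / 4) ^+ s * c.
Proof.
elim: s f g c => [|s IH] f g c c0 f0 g0 fg.
  pose x := [ffun i : 'I_0 => true].
  rewrite !(big_cube0 _ x) expr0.
  by have := fg x x; rewrite /hamming big_ord0 expr0.
have step a b : (\sum_x f (cube_cons a x)) * (\sum_x g (cube_cons b x)) <=
    (25 / 4) ^+ s * (4 ^+ (a != b) * c).
  apply: IH => // [|x y]; first by rewrite mulr_ge0 // exprn_ge0.
  by rewrite mulrCA mulrA -exprD -hamming_cons.
rewrite !big_cube exprS -mulrA.
have S0 h b : (forall x, 0 <= h x) -> 0 <= \sum_x h (cube_cons b x) :> R.
  by move=> h0; apply: sumr_ge0.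
have e0 : 0 <= (25 / 4) ^+ s * c :> R by rewrite mulr_ge0 // exprn_ge0 //; lra.
apply: two_function_base; rewrite ?S0 //.
- by have := step false false; rewrite eqxx expr0 mul1r.
- by have := step true true; rewrite eqxx expr0 mul1r.
- by have := step false true; rewrite /= expr1 mulrCA.
- by have := step true false; rewrite /= expr1 mulrCA.
Qed.

Lemma hamming_compl s (x y : {ffun 'I_s -> bool}) :
  (hamming x [ffun i => ~~ y i] + hamming x y)%N = s.
Proof.
rewrite /hamming -big_split -[RHS]card_ord -sum1_card; apply: eq_bigr => i _.
by rewrite ffunE; case: (x i); case: (y i).
Qed.

(* The two functions are the indicators of Y and of its antipode, which are at
   distance at least s/2. *)
Lemma card_close s (Y : {set {ffun 'I_s -> bool}}) :
  (forall x y, x \in Y -> y \in Y -> (2 * hamming x y <= s)%N) ->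
  #|Y|%:R ^+ 2 <= (25 / 8) ^+ s :> R.
Proof.
move=> close.
have neg_inj : injective (fun y : {ffun 'I_s -> bool} => [ffun i => ~~ y i]).
  move=> y z /ffunP yz; apply/ffunP => i; have := yz i.
  by rewrite !ffunE => /negb_inj.
pose f x : R := (x \in Y)%:R.
pose g (x : {ffun 'I_s -> bool}) : R := ([ffun i => ~~ x i] \in Y)%:R.
have fE : \sum_x f x = #|Y|%:R.
  rewrite -sum1_card natr_sum [RHS]big_mkcond /=.
  by apply: eq_bigr => x _; rewrite /f; case: ifP.
have gE : \sum_x g x = #|Y|%:R.
  rewrite -fE (reindex_inj neg_inj); apply: eq_bigr => x _.
  congr (nat_of_bool (_ \in Y))%:R.
  by apply/ffunP => i; rewrite !ffunE negbK.
(* If [x] and the antipode of [y] lie in [Y], then [x] and [y] are at distance at least s/2, so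
   [4 ^ hamming x y >= 2 ^ s]; hence the choice [c = 2 ^ -s]. *)
have : (\sum_x f x) * (\sum_x g x) <= (25 / 4) ^+ s * (2 ^+ s)^-1.
  apply: two_function => [|x|x|x y]; rewrite ?invr_ge0 ?exprn_ge0 ?ler0n //.
  rewrite /f /g; have [xY|] := boolP (x \in Y); last first.
    by rewrite mul0r mulr_ge0 ?invr_ge0 ?exprn_ge0.
  have [yY|] := boolP (_ \in Y); last first.
    by rewrite mulr0 mulr_ge0 ?invr_ge0 ?exprn_ge0.
  rewrite mul1r ler_pdivlMr ?exprn_gt0 // mul1r.
  rewrite (_ : 4 = 2 ^+ 2); last by rewrite -natrX.
  rewrite -exprM; apply: ler_weXn2l; first by rewrite ler1n.
  have := close _ _ xY yY; have := hamming_compl x y; lia.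
rewrite fE gE expr2 -exprVn -exprMn.
by rewrite (_ : 25 / 4 * 2^-1 = 25 / 8) //; field.
Qed.

(** Otherwise [card_close] bounds the sixth power of the cardinal by [(25/8) ^ (3 s)], and
    [(25/8) ^ 3 < 31 < 2 ^ 5]. *)
Lemma far_pair s (Y : {set {ffun 'I_s -> bool}}) : (0 < s)%N ->
  2 ^+ (5 * s) <= #|Y|%:R ^+ 6 :> R ->
  exists x y, [/\ x \in Y, y \in Y & (s < 2 * hamming x y)%N].
Proof.
move=> s0 Ybig; apply/not_existsP => H.
have le2 : #|Y|%:R ^+ 2 <= (25 / 8) ^+ s :> R.
  apply: card_close => x y xY yY; rewrite leqNgt; apply/negP => xy.
  by apply: (H x); exists y.
have : (#|Y|%:R ^+ 2) ^+ 3 <= ((25 / 8) ^+ s) ^+ 3 :> R.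
  by apply: lerXn2r; rewrite // nnegrE ?exprn_ge0 //; lra.
rewrite -exprM exprAC => le6.
have := le_trans Ybig le6; rewrite exprM; apply/negP; rewrite -ltNge.
rewrite ltrXn2r -?lt0n //; last by lra.
Qed.

End TwoFunctions.

(** * Moments of signed sums, and entropy *)

Section Moments.
Variable R : realFieldType.

Definition signed_sum s (b : 'I_s -> R) (x : {ffun 'I_s -> bool}) : R :=
  \sum_i b i * (-1) ^+ x i.

Lemma signed_sum_cons s (b : 'I_s.+1 -> R) c (x : {ffun 'I_s -> bool}) :
  signed_sum b (cube_cons c x) =
  signed_sum (fun j => b (lift ord0 j)) x + b ord0 * (-1) ^+ c.
Proof.
rewrite /signed_sum big_ord_recl cube_cons0 addrC; congr (_ + _).
by apply: eq_bigr => i _; rewrite cube_consS.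
Qed.

Lemma sum_cube_const s (a : R) : \sum_(x : {ffun 'I_s -> bool}) a = 2 ^+ s * a.
Proof. by rewrite sumr_const card_ffun card_bool card_ord -[LHS]mulr_natl natrX. Qed.

Lemma second_moment s (b : 'I_s -> R) : (forall i, `|b i| <= 1) ->
  \sum_x signed_sum b x ^+ 2 <= 2 ^+ s * s%:R.
Proof.
elim: s b => [|s IH] b b1.
  rewrite (big_cube0 _ [ffun i : 'I_0 => true]) /signed_sum big_ord0.
  by rewrite mulr0 expr0n.
rewrite big_cube -big_split /=.
under eq_bigr => x _ do rewrite !signed_sum_cons.
set X := signed_sum _.
rewrite (eq_bigr (fun x => 2 * X x ^+ 2 + 2 * b ord0 ^+ 2)); last first.
  by move=> x _; rewrite /= expr0 expr1; ring.
rewrite big_split -mulr_sumr sum_cube_const /=.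
have /IH le1 : forall j, `|b (lift ord0 j)| <= 1 by [].
have b2 : b ord0 ^+ 2 <= 1 by rewrite -real_normK ?num_real // exprn_ile1.
have := ler_wpM2l (exprn_ge0 s (ler0n R 2)) b2.
rewrite -/X in le1; rewrite (exprS 2 s) -(natr1 s); lra.
Qed.

(** A new coordinate with coefficient [a] raises the mean fourth power by [6 a^2 E[X^2] + a^4 <= 6 s
    + 1], while [3 s^2] grows by [6 s + 3]. *)
Lemma fourth_moment s (b : 'I_s -> R) : (forall i, `|b i| <= 1) ->
  \sum_x signed_sum b x ^+ 4 <= 2 ^+ s * (3 * s%:R ^+ 2).
Proof.
elim: s b => [|s IH] b b1.
  rewrite (big_cube0 _ [ffun i : 'I_0 => true]) /signed_sum big_ord0.
  by rewrite !expr0n !mulr0.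
rewrite big_cube -big_split /=.
under eq_bigr => x _ do rewrite !signed_sum_cons.
have b1' : forall j, `|b (lift ord0 j)| <= 1 by [].
set X := signed_sum _; set a := b ord0.
rewrite (eq_bigr (fun x => 2 * X x ^+ 4 + 12 * a ^+ 2 * X x ^+ 2 + 2 * a ^+ 4));
  last by move=> x _; rewrite /= expr0 expr1; ring.
rewrite !big_split -!mulr_sumr sum_cube_const /=.
have le4 := IH _ b1'; have le2 := second_moment b1'.
rewrite -/X in le4 le2.
have a2 : a ^+ 2 <= 1 by rewrite -real_normK ?num_real // exprn_ile1 // b1.
have a4 : a ^+ 4 <= 1.
  by rewrite (exprM a 2 2) exprn_ile1 ?sqr_ge0.
have p0 : 0 <= 2 ^+ s :> R by rewrite exprn_ge0.
have X0 : 0 <= \sum_x X x ^+ 2 by apply: sumr_ge0 => x _; rewrite sqr_ge0.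
have h1 : a ^+ 2 * (\sum_x X x ^+ 2) <= 2 ^+ s * s%:R.
  by apply: le_trans le2; rewrite ler_piMl.
have h2 := ler_wpM2l p0 a4.
rewrite (exprS 2 s) -(natr1 s); lra.
Qed.
End Moments.

(** * Gibbs' inequality and fibers of small entropy functions *)

Section Gibbs.
Variables (R : realType) (T : finType).
Hypothesis T0 : (0 < #|T|)%N.

Let T0R : 0 < #|T|%:R :> R. Proof. by rewrite ltr0n. Qed.

Lemma ln2_gt0 : 0 < ln 2 :> R. Proof. by rewrite ln_gt0 // ltr1n. Qed.

Lemma card_fiber_gt0 (Z : eqType) (f : T -> Z) t :
  0 < #|[pred t' | f t' == f t]|%:R :> R.
Proof. by rewrite ltr0n; apply/card_gt0P; exists t; rewrite inE. Qed.

(** Grouped by the value [i] of [k], the terms of a class add up to [w i], or to 0 if the class has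
    no point in [P]. *)
Lemma sum_fiber_le1 (K : eqType) (w : K -> R) (k : T -> K) (P : pred T) :
  (forall i, 0 < w i) ->
  (forall r, uniq r -> \sum_(i <- r) w i <= 1) ->
  \sum_(t | P t) w (k t) / #|[pred t' | P t' && (k t' == k t)]|%:R <= 1.
Proof.
move=> w0 w1.
rewrite -[leRHS]mulr1.
apply: le_trans (_ : \sum_(i <- undup (codom k)) w i <= _); last first.
  by rewrite mulr1 w1 // undup_uniq.
rewrite (eq_bigr (fun t => \sum_(i <- undup (codom k) | k t == i)
    w i / #|[pred t' | P t' && (k t' == i)]|%:R)); last first.
  move=> t _; rewrite big_mkcond (bigD1_seq (k t)) ?undup_uniq ?mem_undup ?codom_f //=.
  by rewrite eqxx big1 ?addr0 // => i; rewrite eq_sym => /negbTE ->.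
rewrite (exchange_big_dep predT) //=; apply: ler_sum => i _.
rewrite sumr_const -[leLHS]mulr_natr.
set c := #|_|.
have [->|c0] := eqVneq c 0%N; first by rewrite mulr0 ltW.
by rewrite divfK // pnatr_eq0.
Qed.

(** The conditional entropy of [k] given [f] is at most its cross entropy against the subprobability
    [w]. This is [ln x <= x - 1] at [x = F * w / G], where [G / F] is the conditional probability of
    the value of [k]. *)
Lemma entropy_pair (Z K : eqType) (f : T -> Z) (k : T -> K) (w : K -> R) :
  (forall i, 0 < w i) ->
  (forall r, uniq r -> \sum_(i <- r) w i <= 1) ->
  entropy R (fun t => (f t, k t)) <=
  entropy R f + #|T|%:R^-1 * \sum_t log2 (1 / w (k t)).
Proof.
move=> w0 w1; rewrite !entropyE -mulrDr ler_pM2l ?invr_gt0 // -big_split /=.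
rewrite -subr_le0 -sumrB.
pose F t : R := #|[pred t' | f t' == f t]|%:R.
pose G t : R := #|[pred t' | (f t' == f t) && (k t' == k t)]|%:R.
have G0 t : 0 < G t by rewrite ltr0n; apply/card_gt0P; exists t; rewrite !inE !eqxx.
have F0 t : 0 < F t by exact: card_fiber_gt0.
apply: le_trans (_ : (ln 2)^-1 * \sum_t (F t * w (k t) / G t - 1) <= _).
  rewrite mulr_sumr; apply: ler_sum => t _.
  rewrite /log2 /unif_prob !div1r -!mulrDl -mulrBl mulrC.
  rewrite ler_pM2l ?invr_gt0 ?ln2_gt0 //.
  rewrite !invfM !invrK.
  rewrite (_ : #|[pred t' | (f t', k t') == (f t, k t)]|%:R = G t); last first.
    by congr (_%:R); apply: eq_card => t'; rewrite !inE xpair_eqE.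
  rewrite -/(F t) lnM ?posrE ?invr_gt0 // lnM ?posrE ?invr_gt0 //.
  have := @le_ln1Dx R (F t * w (k t) / G t - 1); rewrite (addrC 1) subrK ltrBrDr addNr.
  have q0 : 0 < F t * w (k t) / G t by rewrite divr_gt0 // mulr_gt0.
  move=> /(_ q0).
  rewrite !(lnM, lnV, posrE) ?mulr_gt0 ?invr_gt0 // => le.
  apply: le_trans le; lra.
rewrite pmulr_rle0 ?invr_gt0 ?ln2_gt0 // sumrB sumr_const subr_le0.
(* Writing [F t] as a count of [t'] and exchanging the sums leaves, for each [t'], a sum over its
   fiber, at most 1 by [sum_fiber_le1]. *)
rewrite (eq_bigr (fun t => \sum_(t' | f t' == f t) w (k t) / G t)); last first.
  move=> t _; rewrite sumr_const -mulr_natl mulrA /F; by [].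
rewrite (exchange_big_dep predT) //= -sum1_card natr_sum.
apply: ler_sum => t' _.
apply: le_trans (sum_fiber_le1 k (fun t => f t == f t') w0 w1).
rewrite le_eqVlt; apply/orP; left; apply/eqP.
apply: eq_big => [t|t /eqP ft]; first by rewrite eq_sym.
by rewrite /G -ft.
Qed.

Lemma large_fiber (Z : eqType) (f : T -> Z) :
  exists t, log2 (1 / unif_prob R [pred t' | f t' == f t]) <= entropy R f.
Proof.
apply/not_existsP => H.
have : #|T|%:R * entropy R f < \sum_t log2 (1 / unif_prob R [pred t' | f t' == f t]).
  rewrite mulr_natl -sumr_const; apply: ltr_sum => [|t _].
    by have /card_gt0P[t _] := T0; apply/hasP; exists t; rewrite // mem_index_enum.
  by rewrite ltNge; apply/negP; exact: H.
by rewrite entropyE mulrA divff ?gt_eqF // mul1r ltxx.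
Qed.
End Gibbs.

(** * Rounded signed sums *)

Section Rounding.
Variable R : realType.
Implicit Types q u w x : R.

(** The two-sided geometric law on the integers, used as prior for rounded values. *)
Definition geometric q (k : int) : R := (1 - q) / (1 + q) * q ^+ `|k|%N.

Lemma geometric_gt0 q k : 0 < q < 1 -> 0 < geometric q k.
Proof.
move=> /andP[q0 q1]; rewrite mulr_gt0 ?exprn_gt0 // divr_gt0 //; lra.
Qed.

Lemma sum_expr_lt q n : 0 < q < 1 -> \sum_(i <- iota 0 n) q ^+ i <= (1 - q)^-1.
Proof.
move=> /andP[q0 q1]; rewrite -div1r ler_pdivlMr; last by lra.
have -> : \sum_(i <- iota 0 n) q ^+ i = \sum_(i < n) q ^+ i.
  by rewrite -(big_mkord xpredT (fun i => q ^+ i)) /index_iota subn0.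
rewrite -opprB mulrN mulrC -subrX1 opprB.
by have := exprn_gt0 n q0; lra.
Qed.

(** A finite list lies in [[-n, n - 1]]. There the powers of [q] sum to at most [1 / (1 - q)] on the
    nonnegative side and [q / (1 - q)] on the negative side; the total is the inverse of the
    normalizing factor. *)
Lemma sum_geometric q (r : seq int) : 0 < q < 1 -> uniq r ->
  \sum_(k <- r) geometric q k <= 1.
Proof.
move=> /[dup] q01 /andP[q0 q1] ur.
pose n := \max_(k <- r) `|k|%N.+1.
pose r0 := map Posz (iota 0 n) ++ map Negz (iota 0 n).
have ur0 : uniq r0.
  rewrite cat_uniq !map_inj_uniq ?iota_uniq ?andbT //=; try by move=> ? ? [].
  by apply/hasPn => _ /mapP[i _ ->]; apply/negP => /mapP[].
have sub k : k \in r -> k \in r0.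
  move=> kr; have : (`|k| < n)%N by rewrite /n (big_rem k) //= leq_max leqnn.
  rewrite mem_cat; case: k {kr} => k kn; apply/orP; [left|right];
    by apply/map_f; rewrite mem_iota /=; lia.
have -> : \sum_(k <- r) geometric q k = \sum_(k <- r0 | k \in r) geometric q k.
  rewrite -[RHS]big_filter; apply: perm_big; apply: uniq_perm => //.
    by rewrite filter_uniq.
  by move=> k; rewrite mem_filter; have [/sub|] := boolP (k \in r).
apply: le_trans (_ : \sum_(k <- r0) geometric q k <= _).
  rewrite big_mkcond; apply: ler_sum => k _; case: ifP => // _.
  exact/ltW/geometric_gt0.
rewrite big_cat /= !big_map /geometric -!mulr_sumr -mulrDr.
have -> : \sum_(i <- iota 0 n) q ^+ `|Negz i|%N = q * \sum_(i <- iota 0 n) q ^+ i.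
  by rewrite mulr_sumr; apply: eq_bigr => i _; rewrite -exprS.
have := sum_expr_lt n q01; set S := \sum_(i <- _) _ => leS.
have -> : (1 - q) / (1 + q) * (S + q * S) = (1 - q) * S by field; lra.
by rewrite mulrC -ler_pdivlMr ?subr_gt0 // div1r.
Qed.

Definition round w x : int := Num.floor (x / w + 2^-1).

(** Rounding to the nearest integer gives 0 when [|x| < w / 2], and otherwise the error 1/2 is at
    most [|x| / w]. The absence of an additive term makes wide cells cheap. *)
Lemma round_le w x : 0 < w -> `|round w x|%N%:R <= 2 * `|x| / w.
Proof.
move=> w0; rewrite -mulrA -[w in leRHS]gtr0_norm // -normfV -normrM.
set y := x / w; rewrite natr_absz.
have /andP[] := floor_itv (y + 2^-1); rewrite -/(round w x) => fl fu.
have := fl; have := fu; rewrite intrD1.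
set k := round w x => {}fu {}fl.
have [k0|k0|k0] := ltrgt0P k.
- have k1 : 1 <= k%:~R :> R by rewrite ler1z -gtz0_ge1.
  by rewrite gtr0_norm; lra.
- have k1 : k%:~R <= -1 :> R by rewrite -[-1]/((-1)%:~R) ler_int; lia.
  by rewrite ltr0_norm ?mulrNz; lra.
- by rewrite mulr_ge0.
Qed.

Lemma round_eq w x x' : 0 < w -> round w x = round w x' -> `|x - x'| <= w.
Proof.
move=> w0 e; have /andP[l1 u1] := floor_itv (x / w + 2^-1).
have /andP[l2 u2] := floor_itv (x' / w + 2^-1).
rewrite -/(round w x) e in l1 u1; rewrite -/(round w x') in l2 u2.
rewrite -[leRHS]mul1r -ler_pdivrMr // -[w in leLHS]gtr0_norm // -normf_div mulrBl.
by rewrite ler_norml; move: u1 u2; rewrite !intrD1; lra.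
Qed.

(** * Cell widths and the entropy cost of a rounded row *)

Definition root8 x : R := Num.sqrt (Num.sqrt (Num.sqrt x)).

Lemma root8_gt0 x : 0 < x -> 0 < root8 x.
Proof. by move=> x0; rewrite !sqrtr_gt0. Qed.

Lemma root8K x : 0 <= x -> root8 x ^+ 8 = x.
Proof.
move=> x0; rewrite (exprM _ 2 4) sqr_sqrtr ?sqrtr_ge0 // (exprM _ 2 2).
by rewrite !sqr_sqrtr ?sqrtr_ge0.
Qed.

(** The size is dictated by [ln_geometric_bound], chiefly by [8 * 800 / scale <= 1 / 100]. *)
Definition scale : R := 10 ^+ 6.

Lemma scale_gt0 : 0 < scale. Proof. by rewrite exprn_gt0. Qed.

(* The width of the rounding cells for a row of weight [mu] restricted to [s]
   columns, in terms of u = (mu s)^(1/8): as s runs through a geometric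
   sequence the widths add up to O(1 / sqrt mu), while the rounded value still
   has entropy O(mu s). *)
Definition width (mu : R) (s : nat) : R :=
  let u := root8 (mu * s%:R) in scale * u / (Num.sqrt mu * (1 + u) ^+ 2).

Lemma width_gt0 mu s : 0 < mu -> (0 < s)%N -> 0 < width mu s.
Proof.
move=> mu0 s0; have u0 : 0 < root8 (mu * s%:R) by rewrite root8_gt0 // mulr_gt0 // ltr0n.
rewrite divr_gt0 ?mulr_gt0 ?scale_gt0 ?exprn_gt0 ?addr_gt0 //.
by rewrite sqrtr_gt0.
Qed.

(** Follows from [sqrt (mu * s) = u ^ 4]; the left side is the typical size [sqrt s] of a signed
    sum, measured in cells. *)
Lemma sqrt_div_width mu s : 0 < mu -> (0 < s)%N ->
  let u := root8 (mu * s%:R) in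
  Num.sqrt s%:R / width mu s = u ^+ 3 * (1 + u) ^+ 2 / scale.
Proof.
move=> mu0 s0 u; have u0 : 0 < u by rewrite root8_gt0 // mulr_gt0 // ltr0n.
have e : Num.sqrt mu * Num.sqrt s%:R = u ^+ 4.
  rewrite -sqrtrM ?ltW // (exprM _ 2 2) /u /root8.
  by rewrite !sqr_sqrtr ?sqrtr_ge0.
have m0 : 0 < Num.sqrt mu by rewrite sqrtr_gt0.
have -> : Num.sqrt s%:R = u ^+ 4 / Num.sqrt mu by rewrite -e mulrAC divff ?mul1r ?gt_eqF.
have C0 := scale_gt0; rewrite /width -/u; field.
by rewrite !gt_eqF //; lra.
Qed.

(** Here [N] stands for [mu * s] and [E] for the mean absolute rounded value. For [u >= 1] the
    logarithm is bounded and the first bound gives [E = O(N / scale)]; for [u < 1] the second gives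
    [E = O(u ^ 4 * N)], which absorbs [ln q^-1 = O(1 / u)]. *)
Lemma ln_geometric_bound (u E : R) : 0 < u -> 0 <= E ->
  let N := u ^+ 8 in
  let K := u ^+ 3 * (1 + u) ^+ 2 / scale in
  let q := N / (400 * (1 + N)) in
  E <= 2 * K -> E <= 48 * K ^+ 4 ->
  ln ((1 + q) / (1 - q)) + E * ln q^-1 <= N / 50.
Proof.
move=> u0 E0 N K q E1 E4.
have N0 : 0 < N by rewrite exprn_gt0.
have M0 : 0 < 400 * (1 + N) by lra.
have q0 : 0 < q by exact: divr_gt0.
have qN : 400 * q * (1 + N) = N by rewrite /q; field; lra.
have q1 : q <= 1 / 400 by nra.
have qN' : q <= N / 400 by nra.
have q2 : (1 + q) / (1 - q) <= 1 + 4 * q by rewrite ler_pdivrMr; nra.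
have le1 : ln ((1 + q) / (1 - q)) <= N / 100.
  apply: le_trans (_ : ln (1 + 4 * q) <= _).
    by rewrite ler_ln ?posrE ?divr_gt0 //; lra.
  by apply: le_trans (@le_ln1Dx _ _ _) _; lra.
suff : E * ln q^-1 <= N / 100 by lra.
have ln0 : 0 <= ln q^-1.
  by rewrite lnV ?posrE // oppr_ge0 ln_le0 //; lra.
have [u1|u1] := lerP 1 u.
  have N1 : 1 <= N by rewrite exprn_ege1.
  have leq : ln q^-1 <= 800.
    have q3 : q^-1 <= 800 by rewrite -div1r ler_pdivrMr //; nra.
    have q4 : 0 < q^-1 by rewrite invr_gt0.
    exact: le_trans (ltW (ln_sublinear q4)) q3.
  have leE : E <= 8 * N / scale.
    apply: le_trans E1 _; rewrite /K mulrA ler_pM2r ?invr_gt0 ?scale_gt0 //.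
    have -> : N = u ^+ 3 * (u ^+ 2 * u ^+ 3) by rewrite /N; ring.
    have u2 : (1 + u) ^+ 2 <= 4 * u ^+ 2 by nra.
    have u3 : 1 <= u ^+ 3 by rewrite exprn_ege1.
    have u30 : 0 <= u ^+ 3 by lra.
    have : u ^+ 3 * (1 + u) ^+ 2 <= u ^+ 3 * (4 * (u ^+ 2 * u ^+ 3)).
      rewrite ler_wpM2l //; apply: le_trans u2 _.
      by rewrite ler_pM2l // ler_peMr ?sqr_ge0.
    lra.
  apply: le_trans (_ : (8 * N / scale) * 800 <= _).
    by apply: ler_pM => //; rewrite ltW.
  by rewrite /scale; lra.
have u1' : 1 <= u^-1 by rewrite invf_ge1 // ltW.
(* Sum of [ln (400 * (1 + N)) <= 800] and [8 * ln u^-1 <= 8 / u], using [1 <= 1 / u]. *)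
have leq : ln q^-1 <= 808 / u.
  have N1 : N <= 1 by rewrite exprn_ile1 // ltW.
  have r0 : 0 < 400 * (1 + N) by lra.
  have -> : q^-1 = 400 * (1 + N) * u^-1 ^+ 8 by rewrite /q invf_div exprVn.
  rewrite lnM ?posrE ?exprn_gt0 ?invr_gt0 // lnXn ?invr_gt0 //.
  have := ln_sublinear r0.
  have : ln u^-1 < u^-1 by rewrite ln_sublinear // invr_gt0.
  rewrite -[ln u^-1 *+ 8]mulr_natl; lra.
have K0 : 0 <= K.
  by rewrite ltW // divr_gt0 ?scale_gt0 // mulr_gt0 // exprn_gt0 // addr_gt0.
have leE : E <= 48 * (4 * u ^+ 3 / scale) ^+ 4.
  apply: le_trans E4 _; rewrite ler_pM2l // lerXn2r ?nnegrE.
  - by [].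
  - exact: K0.
  - by rewrite ltW // divr_gt0 ?scale_gt0 // mulr_gt0 // exprn_gt0.
  rewrite ler_pM2r ?invr_gt0 ?scale_gt0 // mulrC ler_pM2r ?exprn_gt0 //; nra.
apply: le_trans (_ : (48 * (4 * u ^+ 3 / scale) ^+ 4) * (808 / u) <= _).
  by apply: ler_pM.
have -> : 48 * (4 * u ^+ 3 / scale) ^+ 4 * (808 / u) =
    (48 * 256 * 808) * u ^+ 3 * N / scale ^+ 4.
  have C0 := scale_gt0; rewrite /N; field; rewrite !gt_eqF //.
have u3 : u ^+ 3 <= 1 by rewrite exprn_ile1 // ltW.
have uN : u ^+ 3 * N <= N by rewrite ler_piMl // ltW.
rewrite ler_pdivrMr ?exprn_gt0 ?scale_gt0 // -mulrA.
have C1 : 10 ^+ 6 <= scale by [].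
have C2 : 10 ^+ 6 * scale <= scale ^+ 2 by rewrite expr2 ler_pM2r ?scale_gt0.
have C3 : scale ^+ 2 <= scale ^+ 4 by rewrite ler_eXn2l //; lra.
have C4 : 100 * (48 * 256 * 808) <= scale ^+ 4 by lra.
nra.
Qed.

End Rounding.

(** * Partial colorings from entropy *)

Section HalfColoring.
Variable R : realType.

Lemma card_cube s : #|{: {ffun 'I_s -> bool}}| = (2 ^ s)%N.
Proof. by rewrite card_ffun card_bool card_ord. Qed.

Lemma log2_geometric (q : R) k : 0 < q < 1 ->
  log2 (1 / geometric q k) =
  (ln ((1 + q) / (1 - q)) + `|k|%N%:R * ln q^-1) / ln 2.
Proof.
move=> /andP[q0 q1]; have q2 : 0 < 1 - q by lra.
have q3 : 0 < 1 + q by lra.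
rewrite /log2 div1r /geometric (invfM ((1 - q) / _)) invf_div -exprVn; congr (_ / _).
have r0 : 0 < (1 + q) / (1 - q) by rewrite divr_gt0.
by rewrite (lnM r0) ?posrE ?exprn_gt0 ?invr_gt0 // lnXn ?invr_gt0 // mulr_natl.
Qed.

(** For [mu >= 0], [N] is [mu * s] by [root8K]; the eighth power is kept to match
    [ln_geometric_bound]. *)
Definition prior_rate (mu : R) (s : nat) : R :=
  let N := root8 (mu * s%:R) ^+ 8 in N / (400 * (1 + N)).

Lemma prior_rate01 mu s : 0 < mu -> (0 < s)%N -> 0 < prior_rate mu s < 1.
Proof.
move=> mu0 s0; rewrite /prior_rate; set u := root8 _.
have N0 : 0 < u ^+ 8 by rewrite exprn_gt0 // root8_gt0 // mulr_gt0 // ltr0n.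
by rewrite divr_gt0 ?ltr_pdivrMr //=; lra.
Qed.

(** The first bound uses [2 |X| <= X ^ 2 / sg + sg] and the second moment. The second uses
    [k <= k ^ 4] for natural [k] and the fourth moment, with [48 = 2 ^ 4 * 3]. *)
Lemma mean_round s (b : 'I_s -> R) (mu : R) : (0 < s)%N -> 0 < mu ->
  (forall i, `|b i| <= 1) ->
  let w := width mu s in
  let E := (2 ^+ s)^-1 * \sum_x `|round w (signed_sum b x)|%N%:R in
  E <= 2 * (Num.sqrt s%:R / w) /\ E <= 48 * (Num.sqrt s%:R / w) ^+ 4.
Proof.
move=> s0 mu0 b1 w E; have w0 : 0 < w by exact: width_gt0.
have p0 : 0 < (2 ^+ s)^-1 :> R by rewrite invr_gt0 exprn_gt0.
set sg := Num.sqrt s%:R; have sg0 : 0 < sg by rewrite sqrtr_gt0 ltr0n.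
have sg2 : sg ^+ 2 = s%:R by rewrite sqr_sqrtr.
set X := signed_sum b; split.
  apply: le_trans (_ : (2 ^+ s)^-1 * \sum_x (X x ^+ 2 / sg + sg) / w <= _).
    rewrite ler_pM2l //; apply: ler_sum => x _.
    apply: le_trans (round_le _ w0) _; rewrite ler_pM2r ?invr_gt0 //.
    rewrite -[X x ^+ 2]real_normK ?num_real // -subr_ge0.
    have -> : `|X x| ^+ 2 / sg + sg - 2 * `|X x| = (`|X x| - sg) ^+ 2 / sg.
      by field; rewrite gt_eqF.
    by rewrite divr_ge0 ?sqr_ge0 // ltW.
  rewrite -mulr_suml big_split /= -mulr_suml sum_cube_const.
  rewrite !mulrA ler_pM2r ?invr_gt0 // ler_pdivrMl ?exprn_gt0 //.
  have : (\sum_x X x ^+ 2) / sg <= 2 ^+ s * sg.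
    by rewrite ler_pdivrMr // -mulrA -expr2 sg2 second_moment.
  by lra.
have -> : 48 * (sg / w) ^+ 4 = (2 / w) ^+ 4 * (3 * (sg ^+ 2) ^+ 2).
  by field; rewrite gt_eqF.
rewrite sg2 ler_pdivrMl ?exprn_gt0 // mulrCA.
apply: le_trans (_ : \sum_x (2 / w) ^+ 4 * X x ^+ 4 <= _).
  apply: ler_sum => x _; set k := `|_|%N.
  have : k%:R <= 2 / w * `|X x| by rewrite mulrAC round_le.
  have [->|k0] := eqVneq k 0%N => le.
    by rewrite (exprM (2 / w) 2 2) (exprM (X x) 2 2) mulr_ge0 ?sqr_ge0.
  have k1 : 1 <= k%:R :> R by rewrite ler1n lt0n.
  apply: le_trans (_ : k%:R ^+ 4 <= _); first by rewrite ler_eXnr.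
  rewrite (exprM (X x) 2 2) -[X x ^+ 2]real_normK ?num_real // -exprM -exprMn.
  by rewrite lerXn2r ?nnegrE ?mulr_ge0 ?invr_ge0 ?(ltW w0) //.
by rewrite -mulr_sumr ler_wpM2l ?fourth_moment // exprn_ge0 // mulr_ge0 // invr_ge0 ltW.
Qed.

(** The cost in bits of adjoining one row by [entropy_pair]; being linear in [mu], it adds up over
    all rows to a small multiple of [s]. *)
Lemma rounding_cost s (b : 'I_s -> R) (mu : R) : (0 < s)%N -> 0 < mu ->
  (forall i, `|b i| <= 1) ->
  #|{: {ffun 'I_s -> bool}}|%:R^-1 * \sum_(x : {ffun 'I_s -> bool})
    log2 (1 / geometric (prior_rate mu s) (round (width mu s) (signed_sum b x)))
  <= mu * s%:R / 50 / ln 2.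
Proof.
move=> s0 mu0 b1; have ms0 : 0 < mu * s%:R by rewrite mulr_gt0 // ltr0n.
under eq_bigr do rewrite log2_geometric ?prior_rate01 //.
rewrite -mulr_suml mulrA ler_pM2r ?invr_gt0 ?ln2_gt0 // card_cube natrX.
rewrite big_split /= sum_cube_const -mulr_suml mulrDr mulKf ?expf_neq0 //.
have [E1 E4] := mean_round s0 mu0 b1.
rewrite sqrt_div_width // in E1 E4.
rewrite mulrA -[X in _ <= X / 50](root8K (ltW ms0)).
apply: ln_geometric_bound E1 E4; first exact: root8_gt0.
by rewrite mulr_ge0 ?invr_ge0 ?exprn_ge0 ?sumr_ge0.
Qed.

(** From [1 - x <= exp (- x)] at [x = 1 / 10] one gets [exp (1 / 10) <= 10 / 9], and
    [(10 / 9) ^ 6 < 2]. *)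
Lemma ln2_ge : 3 / 5 <= ln 2 :> R.
Proof.
have e1 : expR (1 / 10) <= 10 / 9 :> R.
  have : (1 + - (1 / 10)) * expR (1 / 10) <= 1 :> R.
    by rewrite -ler_pdivlMr ?expR_gt0 // (div1r (expR _)) -expRN expR_ge1Dx.
  by lra.
rewrite -ler_expR lnK ?posrE // (_ : 3 / 5 = 6 * (1 / 10)); last by field.
rewrite expRM_natl; apply: le_trans (_ : (10 / 9) ^+ 6 <= _); last by lra.
by rewrite lerXn2r ?nnegrE ?expR_ge0 //; lra.
Qed.

(** The functions are adjoined one at a time. The codomain changes at each step, so it is
    existential, and only the fact that [h] determines [f] and the [k i] is retained. *)
Lemma entropy_refine (T : finType) (I : eqType) (K : eqType) (k : I -> T -> K)
    (cost : I -> R) :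
  (forall i (Z : eqType) (f : T -> Z),
     entropy R (fun t => (f t, k i t)) <= entropy R f + cost i) ->
  forall (r : seq I) (Z : eqType) (f : T -> Z),
  exists (Z' : eqType) (h : T -> Z'),
    entropy R h <= entropy R f + \sum_(i <- r) cost i /\
    forall t t', h t = h t' ->
      f t = f t' /\ forall i, i \in r -> k i t = k i t'.
Proof.
move=> kc; elim=> [|i r IH] Z f.
  by exists Z, f; rewrite big_nil addr0; split => // t t' ->.
have [Z' [h [hle hE]]] := IH _ (fun t => (f t, k i t)).
exists Z', h; split.
  by rewrite big_cons addrA; apply: le_trans hle _; rewrite lerD2r.
move=> t t' /hE[[ft kt] kr]; split => // j.
by rewrite inE => /predU1P[->|/kr].
Qed.

(** The fiber has probability at least [2 ^ (- s / 6)], hence at least [2 ^ (5 s / 6)] points; sixth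
    powers avoid fractional exponents. *)
Lemma fiber_card s (Z : eqType) (f : {ffun 'I_s -> bool} -> Z) t :
  log2 (1 / unif_prob R [pred t' | f t' == f t]) <= s%:R / 6 ->
  2 ^+ (5 * s) <= #|finset (fun t' => f t' == f t)|%:R ^+ 6 :> R.
Proof.
rewrite /log2 /unif_prob card_cube div1r invf_div natrX.
have -> : #|[pred t' | f t' == f t]| = #|finset (fun t' => f t' == f t)|.
  by apply: eq_card => t'; rewrite !inE.
set c : R := #|_|%:R; have c0 : 0 < c.
  by rewrite ltr0n; apply/card_gt0P; exists t; rewrite inE.
have p0 : 0 < 2 ^+ s :> R by rewrite exprn_gt0.
rewrite ler_pdivrMr ?ln2_gt0 // => le.
have : ln ((2 ^+ s / c) ^+ 6) <= ln (2 ^+ s).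
  by rewrite !lnXn ?divr_gt0 // -[ln 2 *+ s]mulr_natl; lra.
rewrite ler_ln ?posrE ?exprn_gt0 ?divr_gt0 // expr_div_n ler_pdivrMr ?exprn_gt0 //.
rewrite -exprM (_ : s * 6 = s + 5 * s)%N; last by lia.
by rewrite exprD ler_pM2l.
Qed.

Lemma half_coloring (nA s : nat) (A : 'M[R]_(nA, s)) (Delta : 'I_nA -> R)
    (I : finType) (b : I -> 'I_s -> R) (mu : I -> R) : (0 < s)%N ->
  (forall i, 0 < Delta i) -> approx_entropy Delta A <= s%:R / 10 ->
  (forall i j, `|b i j| <= 1) -> (forall i, 0 < mu i) -> \sum_i mu i <= 2 ->
  exists x y : {ffun 'I_s -> bool},
  [/\ (s < 2 * hamming x y)%N,
      forall i, `|signed_sum (A i) x - signed_sum (A i) y| <= 2 * Delta i &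
      forall i, `|signed_sum (b i) x - signed_sum (b i) y| <= width (mu i) s].
Proof.
move=> s0 D0 HA b1 mu0 mu2.
have [[f [fA fH]] _] := approx_entropy_min A D0.
have T0 : (0 < #|{: {ffun 'I_s -> bool}}|)%N by rewrite card_cube expn_gt0.
have ref i (Z : eqType) (g : {ffun 'I_s -> bool} -> Z) :
    entropy R (fun t => (g t, round (width (mu i) s) (signed_sum (b i) t))) <=
    entropy R g + mu i * s%:R / 50 / ln 2.
  have q01 := prior_rate01 (mu0 i) s0.
  apply: le_trans (entropy_pair T0 g _ _ _) _.
  - by move=> k; exact: geometric_gt0 q01.
  - by move=> r ur; exact: sum_geometric q01 ur.
  - by rewrite lerD2l rounding_cost.
have [Z [h [hH hE]]] := entropy_refine ref (index_enum I) f.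
have [t ht] := large_fiber R T0 h.
(* [1/10 + 1/15 = 1/6]: total weight 2 costs [2 s / (50 ln 2)], at most [s / 15] because
   [ln 2 >= 3 / 5]. *)
have le6 : entropy R h <= s%:R / 6.
  apply: le_trans hH _; rewrite fH -!mulr_suml.
  apply: le_trans (_ : s%:R / 10 + 2 * s%:R / 50 / ln 2 <= _).
    by rewrite lerD // !ler_pM2r ?invr_gt0 ?ln2_gt0 // ltr0n.
  have := ln2_ge; have := ln2_gt0 R => l0 l1.
  have : 2 * s%:R / 50 / ln 2 <= s%:R / 15 :> R.
    rewrite ler_pdivrMr //; have := ler_wpM2l (ler0n R s) l1; lra.
  lra.
have [x [y [xY yY xy]]] := far_pair s0 (fiber_card (le_trans ht le6)).
rewrite !inE in xY yY.
have [fxy kxy] : f x = f y /\ forall i, i \in index_enum I ->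
    round (width (mu i) s) (signed_sum (b i) x) =
    round (width (mu i) s) (signed_sum (b i) y).
  by apply: hE; rewrite (eqP xY) (eqP yY).
have AE i z : (A *m signs R z) i 0 = signed_sum (A i) z.
  by rewrite mxE; apply: eq_bigr => j _; rewrite mxE.
exists x, y; split=> // i.
  have := fA i x; have := fA i y; rewrite !AE fxy => h1 h2.
  rewrite (_ : _ - _ = (signed_sum (A i) x - f y i 0) -
    (signed_sum (A i) y - f y i 0)); last by ring.
  by apply: le_trans (ler_normB _ _) _; lra.
by apply: round_eq; rewrite ?width_gt0 // kxy // mem_index_enum.
Qed.

End HalfColoring.

(** * Random rounding by mean-zero moves *)

Section Roundable.
Variables (R : realType) (m : nat) (IA IB : Type).
Variables (A : IA -> 'I_m -> R) (Delta : IA -> R) (B : IB -> 'I_m -> R).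
Hypothesis Delta0 : forall i, 0 < Delta i.

(* With this constant a move of size a contributes 3 a^2 to the variance proxy;
   since the moves at bit k have size 2^(-k) and 3 (4^(-1) + 4^(-2) + ...) = 1, the
   total is at most the number of moves per bit. *)
Lemma expR_le_quad (z : R) : expR z <= z + expR (3 / 2 * z ^+ 2).
Proof.
(* For [z >= 2/3] already [z <= 3/2 * z ^ 2]. Below, [exp z <= 1 + z + 3/2 * z ^ 2] follows from
   [exp (z / 2) <= 1 / (1 - z / 2)], squared. *)
have [z1|z1] := lerP (2 / 3) z.
  apply: le_trans (_ : expR (3 / 2 * z ^+ 2) <= _); last by lra.
  by rewrite ler_expR; nra.
apply: le_trans (_ : z + (1 + 3 / 2 * z ^+ 2) <= _); last first.
  by rewrite lerD2l expR_ge1Dx.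
have z2 : 0 < 1 - z / 2 by lra.
have e1 : expR (z / 2) <= (1 - z / 2)^-1.
  rewrite -[leLHS]invrK -expRN lef_pV2 ?posrE ?expR_gt0 //.
  exact: expR_ge1Dx.
apply: le_trans (_ : (1 - z / 2)^-1 ^+ 2 <= _).
  rewrite (_ : z = 2 * (z / 2)); last by field.
  rewrite expRM_natl -[X in 1 - X / 2](_ : z = 2 * (z / 2)); last by field.
  by rewrite lerXn2r ?nnegrE ?expR_ge0 // invr_ge0 ltW.
rewrite exprVn -div1r ler_pdivrMr ?exprn_gt0 //.
have : 0 <= z ^+ 2 * (3 / 4 - 5 / 4 * z + 3 / 8 * z ^+ 2).
  by rewrite mulr_ge0 ?sqr_ge0 //; nra.
lra.
Qed.

Definition dot (a x : 'I_m -> R) : R := \sum_j a j * x j.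

Lemma dotD a x y : dot a (fun j => x j + y j) = dot a x + dot a y.
Proof. by rewrite /dot -big_split; apply: eq_bigr => j _; rewrite mulrDr. Qed.

Lemma dotZ a c x : dot a (fun j => c * x j) = c * dot a x.
Proof. by rewrite /dot mulr_sumr; apply: eq_bigr => j _; rewrite mulrCA. Qed.

Lemma eq_dot a x y : x =1 y -> dot a x = dot a y.
Proof. by move=> xy; apply: eq_bigr => j _; rewrite xy. Qed.

Definition diff (y : {ffun 'I_m -> bool}) (x : 'I_m -> R) : 'I_m -> R :=
  fun j => (y j)%:R - x j.

(** A law [p] on the cube with mean [x]: [alpha] and [gamma] bound the deviations on its support,
    and the last clause makes row [i] of [A] sub-Gaussian with variance proxy [nu * Delta i ^ 2]. *)
Definition roundable (x : 'I_m -> R) (alpha nu : R) (gamma : IB -> R) : Prop :=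
  exists p : {ffun 'I_m -> bool} -> R,
  [/\ forall y, 0 <= p y, \sum_y p y = 1,
      forall j, \sum_y p y * (y j)%:R = x j &
  [/\ forall y i, 0 < p y -> `|dot (A i) (diff y x)| <= alpha * Delta i,
      forall y i, 0 < p y -> `|dot (B i) (diff y x)| <= gamma i &
      forall i th, \sum_y p y * expR (th * dot (A i) (diff y x)) <=
                   expR (th ^+ 2 * nu * Delta i ^+ 2 / 2)]].

Lemma roundable_le x al nu ga al' nu' ga' : al <= al' -> nu <= nu' ->
  (forall i, ga i <= ga' i) -> roundable x al nu ga -> roundable x al' nu' ga'.
Proof.
move=> lea len leg [p [p0 p1 px [pA pB pE]]]; exists p; split=> //; split.
- by move=> y i py; apply: le_trans (pA y i py) _; rewrite ler_pM2r.
- by move=> y i py; apply: le_trans (pB y i py) _.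
- move=> i th; apply: le_trans (pE i th) _; rewrite ler_expR ler_pM2r //.
  by rewrite ler_wpM2r ?sqr_ge0 // ler_wpM2l ?sqr_ge0.
Qed.

Lemma roundable_bool (y : {ffun 'I_m -> bool}) x : (forall j, x j = (y j)%:R) ->
  roundable x 0 0 (fun=> 0).
Proof.
move=> xy; pose p z : R := (z == y)%:R.
have pE (F : {ffun 'I_m -> bool} -> R) : \sum_z p z * F z = F y.
  rewrite (bigD1 y) //= /p eqxx mul1r big1 ?addr0 // => z /negbTE ->.
  by rewrite mul0r.
have d0 a : dot a (diff y x) = 0.
  by rewrite /dot big1 // => j _; rewrite /diff xy subrr mulr0.
have pos z : 0 < p z -> z = y.
  by rewrite /p; case: eqP => // _; rewrite ltxx.
exists p; split=> [z||j|].
- by rewrite /p.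
- by under eq_bigr do rewrite -[p _]mulr1; rewrite pE.
- by rewrite pE xy.
split=> [z i /pos ->|z i /pos ->|i th].
- by rewrite d0 normr0 mul0r.
- by rewrite d0 normr0.
- by rewrite pE d0 !(mulr0, mul0r).
Qed.

(** One random move, to [x1] with probability [w] and to [x2] otherwise. Deviations add by the
    triangle inequality. The move has mean zero, so the linear terms of [expR_le_quad] cancel and
    its exponential moment contributes the proxy [3 * a ^ 2]. *)
Lemma roundable_mix (w : R) x x1 x2 al nu ga a (g : IB -> R) : 0 <= w <= 1 ->
  (forall j, x j = w * x1 j + (1 - w) * x2 j) ->
  (forall i, `|dot (A i) (fun j => x1 j - x j)| <= a * Delta i) ->
  (forall i, `|dot (A i) (fun j => x2 j - x j)| <= a * Delta i) ->
  (forall i, `|dot (B i) (fun j => x1 j - x j)| <= g i) ->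
  (forall i, `|dot (B i) (fun j => x2 j - x j)| <= g i) ->
  roundable x1 al nu ga -> roundable x2 al nu ga ->
  roundable x (al + a) (nu + 3 * a ^+ 2) (fun i => ga i + g i).
Proof.
move=> /andP[w0 w1] xE A1 A2 B1 B2 [p1 [p10 p11 p1x [p1A p1B p1E]]].
move=> [p2 [p20 p21 p2x [p2A p2B p2E]]].
have w1' : 0 <= 1 - w by lra.
pose p y := w * p1 y + (1 - w) * p2 y.
have pE (F : {ffun 'I_m -> bool} -> R) :
    \sum_y p y * F y = w * (\sum_y p1 y * F y) + (1 - w) * (\sum_y p2 y * F y).
  by rewrite !mulr_sumr -big_split; apply: eq_bigr => y _; rewrite /p /=; ring.
have dE b y x' : dot b (diff y x) = dot b (diff y x') + dot b (fun j => x' j - x j).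
  by rewrite -dotD; apply: eq_dot => j; rewrite /diff addrA subrK.
have pos y : 0 < p y -> 0 < p1 y \/ 0 < p2 y.
  move=> py; have [q1|] := ltP 0 (p1 y); first by left.
  have [q2|] := ltP 0 (p2 y); first by right.
  move=> q2 q1; move: py; rewrite ltNge => /negP[].
  by rewrite -[leRHS]addr0 lerD // mulr_ge0_le0.
exists p; split=> [y||j|].
- by rewrite addr_ge0 // mulr_ge0.
- by rewrite big_split -!mulr_sumr /= p11 p21; ring.
- by rewrite pE p1x p2x xE.
split=> [y i /pos[]py|y i /pos[]py|i th].
- rewrite (dE _ _ x1) mulrDl; apply: le_trans (ler_normD _ _) _.
  by rewrite lerD ?p1A.
- rewrite (dE _ _ x2) mulrDl; apply: le_trans (ler_normD _ _) _.
  by rewrite lerD ?p2A.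
- rewrite (dE _ _ x1); apply: le_trans (ler_normD _ _) _.
  by rewrite lerD ?p1B.
- rewrite (dE _ _ x2); apply: le_trans (ler_normD _ _) _.
  by rewrite lerD ?p2B.
rewrite pE.
set d1 := dot (A i) (fun j => x1 j - x j) in A1.
set d2 := dot (A i) (fun j => x2 j - x j) in A2.
have d0 : w * d1 + (1 - w) * d2 = 0.
  rewrite -!dotZ -dotD /dot big1 // => j _; rewrite (xE j); ring.
set M := expR (th ^+ 2 * nu * Delta i ^+ 2 / 2) in p1E p2E.
have shift x' q : (forall th, \sum_y q y * expR (th * dot (A i) (diff y x')) <=
    expR (th ^+ 2 * nu * Delta i ^+ 2 / 2)) ->
    \sum_y q y * expR (th * dot (A i) (diff y x)) <=
    expR (th * dot (A i) (fun j => x' j - x j)) * M.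
  move=> qE; apply: le_trans (ler_wpM2l (expR_ge0 _) (qE th)).
  rewrite mulr_sumr; apply: ler_sum => y _.
  by rewrite (dE _ _ x') mulrDr expRD [_ * expR (th * dot _ _)]mulrC mulrCA.
apply: le_trans (_ : (w * expR (th * d1) + (1 - w) * expR (th * d2)) * M <= _).
  rewrite [leRHS]mulrDl -[_ * _ * M]mulrA -[(1 - w) * _ * M]mulrA.
  apply: lerD; apply: ler_wpM2l => //.
    exact/shift/p1E.
  exact/shift/p2E.
have quad d : `|d| <= a * Delta i ->
    expR (th * d) <= th * d + expR (3 / 2 * (th * (a * Delta i)) ^+ 2).
  move=> dle; apply: le_trans (expR_le_quad _) _; rewrite lerD2l ler_expR.
  rewrite ler_pM2l // !exprMn ler_wpM2l ?sqr_ge0 //.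
  rewrite -[d ^+ 2]real_normK ?num_real // -exprMn.
  by rewrite lerXn2r ?nnegrE // (le_trans _ dle).
apply: le_trans (_ : expR (3 / 2 * (th * (a * Delta i)) ^+ 2) * M <= _).
  rewrite ler_wpM2r ?expR_ge0 //.
  have := ler_wpM2l w0 (quad _ (A1 i)); have := ler_wpM2l w1' (quad _ (A2 i)).
  rewrite -/d1 -/d2 !mulrDr.
  have : th * (w * d1 + (1 - w) * d2) = 0 by rewrite d0 mulr0.
  lra.
rewrite /M -expRD ler_expR le_eqVlt; apply/orP; left; apply/eqP; by field.
Qed.
End Roundable.

(** * Eliminating binary digits *)

Section Levels.
Variables (R : realType) (m : nat) (IA IB : Type).
Variables (A : IA -> 'I_m -> R) (Delta : IA -> R) (B : IB -> 'I_m -> R).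
Hypothesis Delta0 : forall i, 0 < Delta i.

Definition coloring (D : {set 'I_m}) (sg : 'I_m -> bool) : 'I_m -> R :=
  fun j => if j \in D then (-1) ^+ sg j else 0.

(** [G i s] is a potential bounding the unscaled displacement of row [i] of [B] still to come at one
    bit with [s] odd numerators: each coloring is paid for by the drop of [G]. It is instantiated by
    [budget]. *)
Variables (G : IB -> nat -> R) (Gmax : IB -> R).
Hypothesis G0 : forall i, 0 <= G i 0.
Hypothesis G_le : forall i s, G i s <= Gmax i.
Hypothesis colorings : forall J : {set 'I_m}, (0 < #|J|)%N ->
  exists (D : {set 'I_m}) (sg : 'I_m -> bool),
  [/\ D \subset J, (#|J| < 2 * #|D|)%N,
      forall i, `|dot (A i) (coloring D sg)| <= Delta i &
      forall i s, (2 * s <= #|J|)%N ->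
        `|dot (B i) (coloring D sg)| + G i s <= G i #|J|].
Variable S : {set 'I_m}.

Local Notation roundable := (roundable A Delta B).

Definition level k (u : 'I_m -> nat) : 'I_m -> R := fun j => (u j)%:R / 2 ^+ k.

Definition valid k (u : 'I_m -> nat) := forall j,
  (u j <= 2 ^ k)%N /\ (j \notin S -> u j = 0%N \/ u j = (2 ^ k)%N).

Definition odd_set (u : 'I_m -> nat) : {set 'I_m} := finset (fun j => odd (u j)).

Definition recolor (u : 'I_m -> nat) (D : {set 'I_m}) (sg : 'I_m -> bool) :
    'I_m -> nat :=
  fun j => if j \in D then (if sg j then (u j).-1 else (u j).+1) else u j.

(* Each partial coloring colors more than half of the remaining coordinates,
   so at most this many of them are needed for s coordinates. *)
Definition rounds (s : nat) : nat := trunc_log 2 s.+1.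

(** The shift by one in [rounds] matters: [2 * s' < s] means [2 * (s' + 1) <= s + 1]. *)
Lemma rounds_half s s' : (2 * s' < s)%N -> (rounds s' < rounds s)%N.
Proof.
move=> ss; apply: trunc_log_max => //.
by have := trunc_logP (isT : 1 < 2)%N (ltn0Sn s'); rewrite expnS /rounds; lia.
Qed.

Lemma rounds_mono s s' : (s' <= s)%N -> (rounds s' <= rounds s)%N.
Proof. by move=> ss; apply: leq_trunc_log. Qed.

(** At level [k.+1] both 0 and the denominator are even, so an odd numerator lies strictly between
    them and belongs to a coordinate of [S]. *)
Lemma recolor_valid k u (D : {set 'I_m}) sg : valid k.+1 u -> D \subset odd_set u ->
  valid k.+1 (recolor u D sg).
Proof.
move=> uv DJ j; have [u1 u2] := uv j; rewrite /recolor.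
have [jD|//] := boolP (j \in D).
have := fintype.subsetP DJ _ jD; rewrite inE => uo.
have e : ~~ odd (2 ^ k.+1)%N by rewrite oddX.
have jS : j \in S.
  by apply/negPn/negP => /u2 [] ju; move: uo e; rewrite ju // => ->.
rewrite jS; split=> //; case: (sg j); first by lia.
by rewrite ltn_neqAle u1 andbT; apply: contra e => /eqP <-.
Qed.

Lemma recolor_odd u (D : {set 'I_m}) sg : D \subset odd_set u ->
  odd_set (recolor u D sg) = odd_set u :\: D.
Proof.
move=> DJ; apply/finset.setP => j; rewrite !inE /recolor.
have [jD|//] := boolP (j \in D).
have := fintype.subsetP DJ _ jD; rewrite inE => uo /=.
by case: (sg j) => /=; rewrite ?uo //; case: (u j) uo => //= n; move=> /negbTE.
Qed.

Lemma level_recolor k u (D : {set 'I_m}) sg : D \subset odd_set u -> forall j,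
  level k (recolor u D sg) j - level k u j = (2 ^+ k)^-1 * coloring D sg j.
Proof.
move=> DJ j; rewrite /level /recolor /coloring -mulrBl mulrC; congr (_ * _).
have [jD|_] := boolP (j \in D); last by rewrite subrr.
have := fintype.subsetP DJ _ jD; rewrite inE => uo.
case: (sg j); last by rewrite -natr1 addrC addKr.
by case: (u j) uo => // n _; rewrite /= -natr1 expr1; ring.
Qed.

(** Induction on the number of odd numerators. With none left, halving all numerators reaches level
    [k]; otherwise a coloring is applied with a fair random sign, which lowers [rounds] by at least
    one. *)
Lemma level_step k al nu ga :
  (forall u, valid k u -> roundable (level k u) al nu ga) ->
  forall u, valid k.+1 u ->
  let s := #|odd_set u| in
  roundable (level k.+1 u) (al + (2 ^+ k.+1)^-1 * (rounds s)%:R)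
    (nu + 3 * (4 ^+ k.+1)^-1 * (rounds s)%:R)
    (fun i => ga i + (2 ^+ k.+1)^-1 * G i s).
Proof.
move=> base u; have [n] := ubnP #|odd_set u|; elim: n u => // n IH u un uv s.
have p0 : 0 < (2 ^+ k.+1)^-1 :> R by rewrite invr_gt0 exprn_gt0.
have [s0|s0] := posnP s.
  have ev j : ~~ odd (u j).
    apply/negP => uo; move/eqP: s0.
    by rewrite cards_eq0 => /eqP/finset.setP/(_ j); rewrite !inE uo.
  have -> : level k.+1 u = level k (fun j => (u j)./2).
    apply/funext => j; rewrite /level -{1}[u j]even_halfK // -muln2 natrM exprSr.
    by rewrite -mulf_div divff ?mulr1 // pnatr_eq0.
  apply: (roundable_le Delta0) (base _ _).
  - by rewrite lerDl mulr_ge0 // ltW.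
  - by rewrite lerDl !mulr_ge0 // invr_ge0 exprn_ge0.
  - by move=> i; rewrite lerDl s0 mulr_ge0 // ltW.
  move=> j; have [u1 u2] := uv j; split.
    by rewrite -leq_double even_halfK // -mul2n -expnS.
  move=> /u2 [->|->]; [by left|right].
  by rewrite expnS mul2n doubleK.
have [D [sg [DJ Ds DA DB]]] := colorings s0.
pose s' := #|odd_set u :\: D|.
have s's : (2 * s' < s)%N.
  by rewrite /s' cardsD (finset.setIidPr DJ) -/s; have := subset_leq_card DJ; lia.
have := rounds_half s's; rewrite -(ler_nat R) -natr1 => rle.
(* The signs are arbitrary: both recolorings, by [sg] and by its opposite, leave the same odd
   set. *)
have IH' sg' : roundable (level k.+1 (recolor u D sg'))
    (al + (2 ^+ k.+1)^-1 * (rounds s')%:R)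
    (nu + 3 * (4 ^+ k.+1)^-1 * (rounds s')%:R)
    (fun i => ga i + (2 ^+ k.+1)^-1 * G i s').
  rewrite /s' -(recolor_odd sg' DJ); apply: IH; last exact: recolor_valid.
  by rewrite recolor_odd // -/s'; apply: leq_trans (_ : s <= n)%N => //; lia.
have flip j : coloring D (fun j => ~~ sg j) j = -1 * coloring D sg j.
  rewrite /coloring; case: ifP => _; rewrite ?mulr0 // mulN1r.
  by case: (sg j); rewrite ?expr0 ?expr1 ?opprK.
have dotm sg' a : dot a (fun j => level k.+1 (recolor u D sg') j - level k.+1 u j) =
    (2 ^+ k.+1)^-1 * dot a (coloring D sg').
  by rewrite -dotZ; apply: eq_dot => j; rewrite level_recolor.
have dotf a : `|dot a (coloring D (fun j => ~~ sg j))| = `|dot a (coloring D sg)|.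
  by rewrite (eq_dot _ flip) dotZ mulN1r normrN.
have h2 : (0 <= (2^-1 : R)) && ((2^-1 : R) <= 1).
  by rewrite invr_ge0 ler0n invf_le1 ?ler1n ?ltr0n.
have hA i : `|(2 ^+ k.+1)^-1 * dot (A i) (coloring D sg)| <= (2 ^+ k.+1)^-1 * Delta i.
  by rewrite normrM gtr0_norm // ler_pM2l.
have hB i : `|(2 ^+ k.+1)^-1 * dot (B i) (coloring D sg)| <=
    (2 ^+ k.+1)^-1 * `|dot (B i) (coloring D sg)|.
  by rewrite normrM gtr0_norm.
have fA i : `|(2 ^+ k.+1)^-1 * dot (A i) (coloring D (fun j => ~~ sg j))| <=
   (2 ^+ k.+1)^-1 * Delta i by rewrite normrM dotf -normrM.
have fB i : `|(2 ^+ k.+1)^-1 * dot (B i) (coloring D (fun j => ~~ sg j))| <=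
    (2 ^+ k.+1)^-1 * `|dot (B i) (coloring D sg)|.
  by rewrite normrM dotf -normrM.
have mix j : level k.+1 u j = 2^-1 * level k.+1 (recolor u D sg) j +
    (1 - 2^-1) * level k.+1 (recolor u D (fun j => ~~ sg j)) j.
  have := level_recolor k.+1 sg DJ j.
  have := level_recolor k.+1 (fun j => ~~ sg j) DJ j.
  rewrite flip; lra.
apply: (roundable_le Delta0) (roundable_mix h2 mix _ _ _ _ (IH' sg) (IH' _));
  last 4 first.
- by move=> i; rewrite dotm; exact: hA.
- by move=> i; rewrite dotm; exact: fA.
- by move=> i; rewrite dotm; exact: hB.
- by move=> i; rewrite dotm; exact: fB.
- have := ler_wpM2l (ltW p0) rle; lra.
- have e4 : (2 ^+ k.+1)^-1 ^+ 2 = (4 ^+ k.+1)^-1 :> R.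
    by rewrite exprVn -exprM mulnC exprM -natrX.
  have q0 : 0 <= 3 * (4 ^+ k.+1)^-1 :> R by rewrite mulr_ge0 // invr_ge0 exprn_ge0.
  by have := ler_wpM2l q0 rle; rewrite e4; lra.
- move=> i; have := ler_wpM2l (ltW p0) (DB i _ (ltnW s's)); rewrite -/s; lra.
Qed.

(** Summing over the bits: [2^-1 + ... + 2^-K = 1 - 2^-K] and
    [3 * (4^-1 + ... + 4^-K) = 1 - 4^-K]. *)
Lemma roundable_level K u : valid K u ->
  let T := (rounds #|S|)%:R in
  roundable (level K u) (T * (1 - (2 ^+ K)^-1)) (T * (1 - (4 ^+ K)^-1))
    (fun i => Gmax i * (1 - (2 ^+ K)^-1)).
Proof.
move=> uv T; elim: K u uv => [|K IH] u uv.
  have u01 j : (u j <= 1)%N by have [] := uv j.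
  rewrite !expr0 invr1 subrr !mulr0.
  rewrite (_ : (fun i => _) = fun=> 0); last by apply/funext => i; rewrite mulr0.
  apply: (@roundable_bool _ _ _ _ _ _ _ [ffun j => u j == 1%N]) => j.
  by rewrite ffunE /level expr0 divr1; case: (u j) (u01 j) => [|[]].
have sJ : (#|odd_set u| <= #|S|)%N.
  apply: subset_leq_card; apply/fintype.subsetP => j; rewrite inE => uo.
  apply/negPn/negP => /(proj2 (uv j))[] ju; move: uo; rewrite ju // oddX //.
have := rounds_mono sJ; rewrite -(ler_nat R) -/T => rT.
have p0 : 0 < (2 ^+ K.+1)^-1 :> R by rewrite invr_gt0 exprn_gt0.
have q0 : 0 < (4 ^+ K.+1)^-1 :> R by rewrite invr_gt0 exprn_gt0.
have e2 : (2 ^+ K)^-1 = 2 * (2 ^+ K.+1)^-1 :> R.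
  by rewrite exprS; field; rewrite expf_neq0.
have e4 : (4 ^+ K)^-1 = 4 * (4 ^+ K.+1)^-1 :> R.
  by rewrite exprS; field; rewrite expf_neq0.
apply: (roundable_le Delta0) (level_step IH uv); rewrite ?e2 ?e4.
- by have := ler_wpM2l (ltW p0) rT; lra.
- by have := ler_wpM2l (ltW q0) rT; lra.
- by move=> i; have := ler_wpM2l (ltW p0) (G_le i #|odd_set u|); lra.
Qed.

(** * Initial random rounding to multiples of [2 ^ -K] *)

Section Dyadic.
Hypothesis A_le : forall i j, `|A i j| <= Delta i.
Hypothesis B_le : forall i j, `|B i j| <= 1.

Let update (x : 'I_m -> R) j0 c : 'I_m -> R := fun j => if j == j0 then c else x j.

Lemma dot_update a x j0 c :
  dot a (fun j => update x j0 c j - x j) = a j0 * (c - x j0).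
Proof.
rewrite /dot (bigD1 j0) //= /update eqxx big1 ?addr0 // => j /negbTE ->.
by rewrite subrr mulr0.
Qed.

(** Coordinates of index below [n] are rounded one by one to a neighbouring multiple. Such a move
    changes one coordinate by at most [2 ^ -K], so the entry bounds [A_le] and [B_le] control it. *)
Lemma roundable_dyadic K (x : 'I_m -> R) n :
  (forall j, 0 <= x j <= 1) ->
  (forall j, j \notin S -> x j = 0 \/ x j = 1) ->
  (forall j : 'I_m, (n <= j)%N -> exists u : nat, x j = u%:R / 2 ^+ K) ->
  let T := (rounds #|S|)%:R in
  roundable x (T + n%:R * (2 ^+ K)^-1) (T + 3 * n%:R * (4 ^+ K)^-1)
    (fun i => Gmax i + n%:R * (2 ^+ K)^-1).
Proof.
move=> + + + T; have p0 : 0 < (2 ^+ K)^-1 :> R by rewrite invr_gt0 exprn_gt0.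
have q0 : 0 < (4 ^+ K)^-1 :> R by rewrite invr_gt0 exprn_gt0.
have P0 : 0 < 2 ^+ K :> R by rewrite exprn_gt0.
have T0 : 0 <= T by rewrite ler0n.
have G00 i : 0 <= Gmax i by exact: le_trans (G0 i) (G_le i 0).
elim: n x => [|n IH] x x01 xS xd.
  pose u j : nat := Num.truncn (x j * 2 ^+ K).
  have uE j : (u j)%:R = x j * 2 ^+ K.
    by have [v vE] := xd j (leq0n j); rewrite /u vE divfK ?gt_eqF // natrK.
  have -> : x = level K u by apply/funext => j; rewrite /level uE mulfK ?gt_eqF.
  apply: (roundable_le Delta0) (roundable_level _).
  - by rewrite mul0r addr0 ler_piMr // gerBl ltW.
  - by rewrite mulr0 mul0r addr0 ler_piMr // gerBl ltW.
  - by move=> i; rewrite mul0r addr0 ler_piMr // gerBl ltW.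
  move=> j; split.
    by rewrite -(ler_nat R) uE natrX ler_piMl ?(ltW P0) //; have /andP[] := x01 j.
  by move=> /xS[] xj; [left|right]; apply/eqP; rewrite -(eqr_nat R) uE xj
    ?mul0r ?mul1r ?natrX.
have [mn|nm] := leqP m n.
  apply: (roundable_le Delta0) (IH x x01 xS _).
  - by rewrite -natr1; lra.
  - by rewrite -natr1; lra.
  - by move=> i; rewrite -natr1; lra.
  - by move=> j nj; have := ltn_ord j; lia.
pose j0 := Ordinal nm; pose z := x j0 * 2 ^+ K; pose g := Num.truncn z.
have /andP[x0 x1] := x01 j0.
have z0 : 0 <= z by rewrite mulr_ge0 // ltW.
have /andP[gz zg] := truncn_itv z0; rewrite -/g in gz zg.
have xz : x j0 = z / 2 ^+ K by rewrite /z mulfK ?gt_eqF.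
have [zE|zN] := eqVneq z g%:R.
  apply: (roundable_le Delta0) (IH x x01 xS _).
  - by rewrite -natr1; lra.
  - by rewrite -natr1; lra.
  - by move=> i; rewrite -natr1; lra.
  - move=> j; rewrite leq_eqVlt => /predU1P[nj|]; last exact: xd.
    by exists g; rewrite (_ : j = j0) ?xz ?zE //; apply: val_inj.
have {}gz : g%:R < z by rewrite lt_neqAle eq_sym zN.
have gK : (g < 2 ^ K)%N.
  by rewrite -(ltr_nat R) natrX; apply: lt_le_trans gz _; rewrite ler_piMl // ltW.
have jS : j0 \in S.
  apply/negPn/negP => /xS[] xj; move: gz; rewrite /g /z xj.
    by rewrite mul0r ltNge ler0n.
  by rewrite mul1r -natrX natrK ltxx.
rewrite -natr1 in zg.
(* Rounding up with probability the fractional part preserves the mean. *)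
pose w := z - g%:R.
have w01 : (0 <= w) && (w <= 1) by rewrite /w; apply/andP; split; lra.
have near a c : `|c - z| <= 1 -> forall d, `|a j0| <= d ->
    `|dot a (fun j => update x j0 (c / 2 ^+ K) j - x j)| <= (2 ^+ K)^-1 * d.
  move=> cz d ad; rewrite dot_update xz -mulrBl normrM normrM mulrC.
  by rewrite (gtr0_norm p0) ler_pM ?mulr_ge0 ?(ltW p0) ?ler_piMl ?(ltW p0).
have z1 : `|g.+1%:R - z| <= 1 by rewrite -natr1 ler_norml; apply/andP; split; lra.
have z2 : `|g%:R - z| <= 1 by rewrite ler_norml; apply/andP; split; lra.
have upd c : (c <= 2 ^ K)%N ->
    roundable (update x j0 (c%:R / 2 ^+ K)) (T + n%:R * (2 ^+ K)^-1)
    (T + 3 * n%:R * (4 ^+ K)^-1) (fun i => Gmax i + n%:R * (2 ^+ K)^-1).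
  move=> cK; apply: IH => [j|j jN|j nj]; rewrite /update; case: eqVneq => [je|jne].
  - by rewrite divr_ge0 ?(ltW P0) // ler_pdivrMr // mul1r -natrX ler_nat.
  - exact: x01.
  - by rewrite je jS in jN.
  - exact: xS.
  - by exists c.
  - by apply: xd; rewrite ltn_neqAle nj andbT; apply: contra jne => /eqP nj';
      apply/eqP/val_inj.
have mix j : x j = w * update x j0 (g.+1%:R / 2 ^+ K) j +
    (1 - w) * update x j0 (g%:R / 2 ^+ K) j.
  rewrite /update; case: eqVneq => [->|_]; last by ring.
  by rewrite xz -natr1 /w; field; rewrite gt_eqF.
apply: (roundable_le Delta0) (roundable_mix w01 mix _ _ _ _ (upd _ _) (upd _ _));
  last 6 first.
- by move=> i; apply: near.
- by move=> i; apply: near.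
- by move=> i; apply: (near (B i) _ z1 1).
- by move=> i; apply: (near (B i) _ z2 1).
- by [].
- exact: ltnW.
- by rewrite -natr1; lra.
- have -> : (2 ^+ K)^-1 ^+ 2 = (4 ^+ K)^-1 :> R.
    by rewrite exprVn -exprM mulnC exprM -natrX.
  by rewrite -natr1; lra.
- by move=> i; rewrite -natr1; lra.
Qed.
End Dyadic.
End Levels.

(** * Colorings of column subsets, and vertices *)

Section Budget.
Variable R : realType.

(* Total displacement allowed to a row of weight [mu] while its number of
   active columns decreases from [s] to 0, halving at each step. *)
Definition budget (mu : R) (s : nat) : R :=
  let u := root8 (mu * s%:R) in
  25 / 4 * scale R / Num.sqrt mu * (u / (1 + u)).

Lemma root8_ge0 (x : R) : 0 <= root8 x. Proof. exact: sqrtr_ge0. Qed.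

Lemma budget_ge0 mu s : 0 <= budget mu s.
Proof.
have u0 := root8_ge0 (mu * s%:R).
by rewrite !mulr_ge0 ?invr_ge0 ?sqrtr_ge0 ?addr_ge0 // ltW ?scale_gt0.
Qed.

Lemma budget_le mu s : budget mu s <= 25 / 4 * scale R / Num.sqrt mu.
Proof.
have u0 := root8_ge0 (mu * s%:R).
rewrite ler_piMr ?ler_pdivrMr ?mul1r ?lerDr //; last by lra.
by rewrite !mulr_ge0 ?invr_ge0 ?sqrtr_ge0 // ltW ?scale_gt0.
Qed.

(** Halving [s] shrinks [u] by [2 ^ (-1/8) < 23/25], so [u / (1 + u)] drops by at least
    [2/25 * u / (1 + u) ^ 2]; and [25/4 * 2/25 = 1/2]. *)
Lemma width_budget (mu : R) s s' : 0 < mu -> (0 < s)%N -> (2 * s' <= s)%N ->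
  width mu s / 2 + budget mu s' <= budget mu s.
Proof.
move=> mu0 s0 ss; rewrite /width /budget.
have ms : 0 < mu * s%:R by rewrite mulr_gt0 // ltr0n.
have ms' : 0 <= mu * s'%:R by rewrite mulr_ge0 // ltW.
set u := root8 (mu * s%:R); set v := root8 (mu * s'%:R).
have u0 : 0 < u by exact: root8_gt0.
have v0 : 0 <= v by exact: root8_ge0.
have vu : v <= 23 / 25 * u.
  have r0 : 0 <= 23 / 25 * u by lra.
  rewrite leNgt; apply/negP => lt.
  have : (23 / 25 * u) ^+ 8 < v ^+ 8 by rewrite ltrXn2r.
  rewrite (exprMn_comm _ (mulrC _ _)) !root8K ?(ltW ms) //.
  have : 1 / 2 * (mu * s%:R) < (23 / 25) ^+ 8 * (mu * s%:R).
    by rewrite ltr_pM2r //; lra.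
  set c := (23 / 25) ^+ 8 * _.
  have : 2 * s'%:R <= s%:R :> R by rewrite -natrM ler_nat.
  move=> /(ler_wpM2l (ltW mu0)); lra.
have c0 : 0 < scale R / Num.sqrt mu by rewrite divr_gt0 ?scale_gt0 ?sqrtr_gt0.
have m0 : 0 < Num.sqrt mu by rewrite sqrtr_gt0.
have u1 : 0 < 1 + u by lra.
have -> : scale R * u / (Num.sqrt mu * (1 + u) ^+ 2) / 2 =
    scale R / Num.sqrt mu * (1 / 2 * (u / (1 + u) ^+ 2)).
  by field; rewrite !gt_eqF.
have bE x : 25 / 4 * scale R / Num.sqrt mu * x =
    scale R / Num.sqrt mu * (25 / 4 * x) by ring.
rewrite !bE -mulrDr ler_pM2l //.
suff : v / (1 + v) <= u / (1 + u) - 2 / 25 * (u / (1 + u) ^+ 2) by lra.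
have -> : u / (1 + u) - 2 / 25 * (u / (1 + u) ^+ 2) =
  (u * (23 / 25 + u)) / (1 + u) ^+ 2 by field; lra.
have v1 : 0 < 1 + v by lra.
rewrite ler_pdivrMr // mulrAC ler_pdivlMr ?exprn_gt0 //.
have : 0 <= (23 / 25 * u - v) * (1 + 27 / 25 * u) by rewrite mulr_ge0 //; lra.
by have := sqr_ge0 u; lra.
Qed.
End Budget.

Section Colorings.
Variables (R : realType) (nA m : nat) (A : 'M[R]_(nA, m)) (Delta : 'I_nA -> R).
Variables (I : finType) (B : I -> 'I_m -> R) (mu : I -> R).
Hypothesis Delta0 : forall i, 0 < Delta i.
Hypothesis A_entropy : forall J : {set 'I_m},
  approx_entropy Delta (col_submx A J) <= #|J|%:R / 10.
Hypothesis B_le : forall i j, `|B i j| <= 1.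
Hypothesis mu0 : forall i, 0 < mu i.
Hypothesis mu_sum : \sum_i mu i <= 2.

(** The coloring is half the difference of the two sign vectors from [half_coloring], carried over
    to [J]; halving turns [2 * Delta] into [Delta] and the width into half of it. *)
Lemma exists_coloring (J : {set 'I_m}) : (0 < #|J|)%N ->
  exists (D : {set 'I_m}) (sg : 'I_m -> bool),
  [/\ D \subset J, (#|J| < 2 * #|D|)%N,
      forall i, `|dot (A i) (coloring R D sg)| <= Delta i &
      forall i s, (2 * s <= #|J|)%N ->
        `|dot (B i) (coloring R D sg)| + budget (mu i) s <= budget (mu i) #|J|].
Proof.
move=> J0; have [j1 j1J] := card_gt0P J0.
pose b i (k : 'I_#|J|) := B i (enum_val k).
have [x [y [xy hA hB]]] := half_coloring J0 Delta0 (A_entropy J)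
  (fun i k => B_le i (enum_val k)) mu0 mu_sum.
pose rk := enum_rank_in j1J.
pose D := finset (fun j => (j \in J) && (x (rk j) != y (rk j))).
pose sg j := x (rk j).
have DJ : D \subset J by apply/fintype.subsetP => j; rewrite inE => /andP[].
have dE a : dot a (coloring R D sg) =
    (signed_sum (fun k => a (enum_val k)) x - signed_sum (fun k => a (enum_val k)) y) / 2.
  rewrite /dot (bigID (mem J)) /= addrC big1 ?add0r; last first.
    by move=> j jJ; rewrite /coloring inE (negbTE jJ) /= mulr0.
  rewrite big_enum_val /= /signed_sum -sumrB mulr_suml; apply: eq_bigr => k _.
  rewrite /coloring inE enum_valP /sg /rk enum_valK_in /=.
  case: (x k); case: (y k); rewrite /= ?expr0 ?expr1; by field.
exists D, sg; split=> //.
- apply: leq_trans xy _; rewrite leq_mul2l /= /hamming.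
  rewrite -[leqRHS]sum1_card [leqRHS]big_mkcond [leqRHS](bigID (mem J)) /=.
  apply: leq_trans (leq_addr _ _); rewrite [leqRHS]big_enum_val /=.
  apply: leq_sum => k _.
  by rewrite inE enum_valP /rk enum_valK_in /=; case: (_ == _).
- move=> i; rewrite dE normrM [X in _ * X]gtr0_norm ?invr_gt0 // ler_pdivrMr // mulrC.
  have := hA i; rewrite /col_submx.
  rewrite (_ : (fun k => A i (enum_val k)) = (colsub (fun k : 'I_#|J| => enum_val k) A) i) //.
  by apply/funext => k; rewrite mxE.
- move=> i s ss; apply: le_trans (width_budget (mu0 i) J0 ss).
  rewrite lerD2r dE normrM [X in _ * X]gtr0_norm ?invr_gt0 // ler_pM2r ?invr_gt0 //.
Qed.

(** On a single column, a coloring of more than half of it colors the column, so its discrepancy is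
    the entry itself. *)
Lemma entry_le i j : `|A i j| <= Delta i.
Proof.
have J1 : #|finset.set1 j| = 1%N by exact: cards1.
have [|D [sg [DJ Dc DA _]]] := @exists_coloring (finset.set1 j).
  by rewrite J1.
have DE : D = finset.set1 j.
  by apply/eqP; rewrite eqEcard DJ J1; move: Dc; rewrite J1; lia.
have := DA i; rewrite /dot (bigD1 j) //= big1 ?addr0.
  by rewrite /coloring DE finset.in_set1 eqxx normrM normrX normrN1 expr1n mulr1.
by move=> k /negbTE kj; rewrite /coloring DE finset.in_set1 kj mulr0.
Qed.

End Colorings.

(** * Reduction to few fractional coordinates *)

Section Vertex.
Variable R : realType.

Definition fractional m (x : 'I_m -> R) : {set 'I_m} :=
  finset (fun j => (x j != 0) && (x j != 1)).

Lemma kernel_vector m r (M : 'I_r -> 'I_m -> R) (F : {set 'I_m}) : (r < #|F|)%N ->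
  exists d : 'I_m -> R, [/\ exists j, d j != 0, forall j, j \notin F -> d j = 0 &
    forall i, dot (M i) d = 0].
Proof.
move=> rF; have [j1 j1F] : exists j, j \in F by apply/card_gt0P; lia.
pose N : 'M[R]_(#|F|, r) := \matrix_(k, i) M i (enum_val k).
have kN : kermx N != 0.
  rewrite kermx_eq0 /row_free; apply/negP => /eqP rk.
  by have := rank_leq_col N; lia.
pose v := nz_row (kermx N).
have v0 : v != 0 by rewrite nz_row_eq0.
have vN : v *m N = 0 by apply/sub_kermxP; exact: nz_row_sub.
pose rk := enum_rank_in j1F.
exists (fun j => if j \in F then v 0 (rk j) else 0); split.
- have [k vk] : exists k, v 0 k != 0.
    by apply/rV0Pn.
  by exists (enum_val k); rewrite enum_valP /rk enum_valK_in.
- by move=> j /negbTE ->.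
move=> i; have := congr1 (fun w : 'rV_r => w 0 i) vN; rewrite !mxE => e; rewrite -[RHS]e.
rewrite /dot (bigID (mem F)) /= addrC big1 ?add0r; last first.
  by move=> j /negbTE ->; rewrite /= mulr0.
rewrite big_enum_val /=; apply: eq_bigr => k _.
by rewrite enum_valP /rk enum_valK_in mxE mulrC.
Qed.

Lemma move_to_boundary m (x d : 'I_m -> R) : (forall j, 0 <= x j <= 1) ->
  (exists j, d j != 0) -> (forall j, j \notin fractional x -> d j = 0) ->
  exists t, (forall j, 0 <= x j + t * d j <= 1) /\
    fractional (fun j => x j + t * d j) \proper fractional x.
Proof.
move=> x01 [j1 dj1] dF.
(* Time at which coordinate [j] leaves the unit interval; the value is meaningless for [d j = 0],
   which the minimum excludes. *)
pose T j := if 0 < d j then (1 - x j) / d j else x j / - d j.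
have [j0 dj0 jmin] := @arg_minP _ _ _ j1 (fun j => d j != 0) T dj1.
have F0 : j0 \in fractional x by apply/negPn/negP => /dF e; rewrite e eqxx in dj0.
exists (T j0).
have T0 : 0 <= T j0.
  rewrite /T; have /andP[? ?] := x01 j0; case: ltP => h.
    by rewrite divr_ge0 ?subr_ge0 // ltW.
  by rewrite divr_ge0 // oppr_ge0.
have e0 : x j0 + T j0 * d j0 = if 0 < d j0 then 1 else 0.
  rewrite /T; case: ltP => h; first by rewrite divfK //= addrC subrK.
  by rewrite invrN mulrN mulNr divfK // subrr.
split=> [j|].
  have /andP[xj0 xj1] := x01 j.
  have [d0|dn0] := eqVneq (d j) 0; first by rewrite d0 mulr0 addr0 xj0.
  have := jmin j dn0; rewrite {2}/T; case: ltP => dj.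
    rewrite ler_pdivlMr // => h; apply/andP; split; last by lra.
    by rewrite addr_ge0 // mulr_ge0 // ltW.
  have {}dj : d j < 0 by rewrite lt_neqAle dn0.
  rewrite ler_pdivlMr ?oppr_gt0 // => h; apply/andP; split; first by lra.
  by have := mulr_ge0_le0 T0 (ltW dj); lra.
apply/properP; split.
  apply/fintype.subsetP => j; rewrite [in X in X -> _]inE => jF.
  by apply/negPn/negP => /[dup] /dF dj; rewrite inE; move: jF; rewrite dj mulr0 addr0 => ->.
by exists j0; rewrite // inE e0; case: ifP => _; rewrite /= eqxx ?andbF.
Qed.

(** While more than [r] coordinates are fractional, a direction supported on them is orthogonal to
    all rows of [M], and following it to the boundary removes one of them. *)
Lemma few_fractional m r (M : 'I_r -> 'I_m -> R) (x : 'I_m -> R) :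
  (forall j, 0 <= x j <= 1) ->
  exists z : 'I_m -> R, [/\ forall j, 0 <= z j <= 1,
    forall i, dot (M i) z = dot (M i) x & (#|fractional z| <= r)%N].
Proof.
have [n] := ubnP #|fractional x|; elim: n x => // n IH x xn x01.
have [le|lt] := leqP #|fractional x| r; first by exists x.
have [d [d0 dF dM]] := kernel_vector M lt.
have [t [t01 tF]] := move_to_boundary x01 d0 dF.
have [|z [z01 zM zF]] := IH _ _ t01; first exact: leq_trans (proper_card tF) _.
exists z; split=> // i; rewrite zM dotD dotZ dM mulr0 addr0 //.
Qed.
End Vertex.

(** * Finitely supported probabilities *)

Section FiniteProbability.
Variables (R : realType) (N : nat) (q : nat -> {nonneg R}).
Hypothesis q1 : \sum_(n < N) (q n)%:num = 1.

Definition atoms : {measure set nat -> \bar R} :=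
  msum (fun n => mscale (q n) (@dirac _ nat n R)) N.

Lemma atomsE (U : set nat) :
  atoms U = (\sum_(n < N) (q n)%:num * (nat_of_ord n \in U)%:R)%:E.
Proof.
rewrite /atoms /= /msum -sumEFin; apply: eq_bigr => n _.
by rewrite /= /mscale /= diracE EFinM.
Qed.

(** Normalizing supplies the probability structure; the mass being 1, it does not change the measure
    ([atomicE]). *)
Definition atomic : probability nat R := mnormalize atoms (@dirac _ nat 0%N R).

Lemma atomicE (U : set nat) : atomic U = atoms U.
Proof.
have e : atoms setT = 1%E.
  rewrite atomsE; congr (_%:E); rewrite -[RHS]q1; apply: eq_bigr => n _.
  by rewrite mem_set // mulr1.
rewrite /atomic /= /mnormalize e /=.
by rewrite onee_eq0 /= invr1 mule1.
Qed.

Lemma expectation_atomic (X : nat -> R) :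
  ('E_atomic[X] = (\sum_(n < N) (q n)%:num * X n)%:E)%E.
Proof.
have mX (f : nat -> \bar R) : measurable_fun setT f by [].
have ge0 (f : nat -> \bar R) : (forall n, 0 <= f n)%E ->
    (\int[atomic]_n f n = \sum_(n < N) (q n)%:num%:E * f n)%E.
  move=> f0.
  rewrite (eq_measure_integral atoms); last by move=> U _ _; exact: atomicE.
  rewrite /atoms ge0_integral_measure_sum //; apply: eq_bigr => n _.
  by rewrite ge0_integral_mscale // integral_dirac // diracT mul1e.
rewrite unlock integralE !ge0 //.
under eq_bigr do rewrite funeposE -EFin_max -EFinM.
under [X in (_ - X)%E]eq_bigr do rewrite funenegE -EFinN -EFin_max -EFinM.
rewrite !sumEFin -EFinB -sumrB; congr (_%:E); apply: eq_bigr => n _.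
by rewrite -mulrBr; congr (_ * _); case: leP => h; case: leP => h'; lra.
Qed.
End FiniteProbability.

Lemma finite_realization (R : realType) m (p : {ffun 'I_m -> bool} -> R) :
  (forall y, 0 <= p y) -> \sum_y p y = 1 ->
  exists (d : measure_display) (Omega : measurableType d)
    (P : probability Omega R) (Y : 'I_m -> {RV P >-> bool}),
  let z w := [ffun j => Y j w] in
  [/\ forall w, 0 < p (z w),
      forall F, ('E_P[fun w => F (z w)] = (\sum_y p y * F y)%:E)%E &
      forall Q : pred {ffun 'I_m -> bool},
        (P [set w | Q (z w)] = (\sum_(y | Q y) p y)%:E)%E].
Proof.
move=> p0 p1.
have [y1 py1] : exists y1, 0 < p y1.
  apply/not_existsP => H; have : \sum_y p y <= 0.
    by apply: sumr_le0 => y _; rewrite leNgt; apply/negP/H.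
  by rewrite p1 ler10.
pose e n := nth y1 (enum {: {ffun 'I_m -> bool}}) n.
pose N := #|{: {ffun 'I_m -> bool}}|.
have sumE (F : {ffun 'I_m -> bool} -> R) : \sum_y F y = \sum_(n < N) F (e n).
  rewrite big_enum_val /=; apply: eq_bigr => n _; congr F.
  exact: enum_val_nth.
pose q n : {nonneg R} := NngNum (p0 (e n)).
have q1 : \sum_(n < N) (q n)%:num = 1 by rewrite -p1 sumE.
(* Outcomes of weight zero are redirected to [y1], so that bounds on the support hold at every
   sample point and not merely almost surely. *)
pose z0 n := if 0 < p (e n) then e n else y1.
pose Y0 j (n : nat) : bool := z0 n j.
have mY j : measurable_fun setT (Y0 j) by [].
pose Y j : {mfun nat >-> bool} := HB.pack (Y0 j) (isMeasurableFun.Build _ _ _ _ _ (mY j)).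
have zE n : [ffun j => Y j n] = z0 n by apply/ffunP => j; rewrite ffunE.
have pz (F : {ffun 'I_m -> bool} -> R) n : p (e n) * F (z0 n) = p (e n) * F (e n).
  rewrite /z0; case: ifPn => //; rewrite -leNgt => pe.
  by have -> : p (e n) = 0; [apply/eqP; rewrite eq_le pe p0 | rewrite !mul0r].
exists _, nat, (atomic N q), Y; split=> [w|F|Q].
- by rewrite zE /z0; case: ifP.
- rewrite (_ : (fun w => _) = F \o z0); last by apply/funext => n /=; rewrite zE.
  rewrite expectation_atomic // sumE; congr (_%:E); apply: eq_bigr => n _.
  exact: pz.
rewrite atomicE // atomsE [in RHS]big_mkcond sumE; congr (_%:E).
apply: eq_bigr => n _.
have -> : (nat_of_ord n \in [set w | Q [ffun j => Y j w]]) = Q (z0 n).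
  by apply/idP/idP; rewrite inE /= zE.
by rewrite (pz (fun y => (Q y)%:R)); case: (Q _); rewrite ?mulr1 ?mulr0.
Qed.

(** * Tail bound and conclusion *)

(** Chernoff's bound with parameter [lambda / V], both tails at once through
    [exp |z| <= exp z + exp (- z)]. *)
Lemma mgf_tail (R : realType) (T : finType) (p D : T -> R) (V lambda : R) :
  (forall y, 0 <= p y) -> 0 < V -> 0 <= lambda ->
  (forall th, \sum_y p y * expR (th * D y) <= expR (th ^+ 2 * V ^+ 2 / 2)) ->
  \sum_(y | lambda * V <= `|D y|) p y <= 2 * expR (- (lambda ^+ 2 / 2)).
Proof.
move=> p0 V0 l0 mgf; pose th := lambda / V.
have thV : th * V = lambda by rewrite divfK ?gt_eqF.
have th0 : 0 <= th by rewrite divr_ge0 // ltW.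
have E0 : 0 < expR (- lambda ^+ 2) by exact: expR_gt0.
apply: le_trans (_ : \sum_y expR (- lambda ^+ 2) *
    (p y * expR (th * D y) + p y * expR (- th * D y)) <= _).
  rewrite big_mkcond; apply: ler_sum => y _; case: ifP => [le|_]; last first.
    by rewrite mulr_ge0 ?expR_ge0 // addr_ge0 // mulr_ge0 ?expR_ge0.
  rewrite -mulrDr mulrCA -[leLHS]mulr1 ler_wpM2l //.
  have le1 : lambda ^+ 2 <= `|th * D y|.
    by rewrite normrM (ger0_norm th0) expr2 -{1}thV -mulrA ler_wpM2l // mulrC.
  have le2 : expR `|th * D y| <= expR (th * D y) + expR (- th * D y).
    rewrite mulNr; case: ger0P => _.
      by rewrite lerDl expR_ge0.
    by rewrite lerDr expR_ge0.
  apply: le_trans (_ : expR (- lambda ^+ 2) * expR `|th * D y| <= _).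
    by rewrite -expRD -[leLHS]expR0 ler_expR; lra.
  by rewrite ler_pM2l.
rewrite -mulr_sumr big_split /=.
have e : th ^+ 2 * V ^+ 2 = lambda ^+ 2 by rewrite -exprMn thV.
have h1 := mgf th; have := mgf (- th); rewrite sqrrN => h2.
rewrite e in h1 h2.
apply: le_trans (_ : expR (- lambda ^+ 2) * (2 * expR (lambda ^+ 2 / 2)) <= _).
  by rewrite ler_pM2l //; lra.
rewrite mulrCA ler_pM2l // -expRD ler_expR; lra.
Qed.

(** With [n, m >= 1], [s + 1] is at most both [2 m] and [3 n], hence
    [4 * (s + 1) <= 3 * min (4 n, 4 m)]; the factor 3/4 is the slack. *)
Lemma rounds_log2 (R : realType) n m s : (0 < n)%N -> (0 < m)%N ->
  (s <= m)%N -> (s <= n.+1)%N ->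
  (rounds s)%:R + (ln 4 - ln 3) / ln 2 <= log2 (minn (4 * n) (4 * m))%:R :> R.
Proof.
move=> n0 m0 sm sn; have l2 := ln2_gt0 R.
rewrite /log2 ler_pdivlMr // mulrDl divfK ?gt_eqF //.
have min0 : 0 < (minn (4 * n) (4 * m))%:R :> R by rewrite ltr0n; lia.
suff : ln (2 ^+ rounds s * 4 : R) <= ln (3 * (minn (4 * n) (4 * m))%:R).
  rewrite !lnM ?posrE ?exprn_gt0 // lnXn // -[ln 2 *+ _]mulr_natl; lra.
rewrite ler_ln ?posrE ?mulr_gt0 ?exprn_gt0 // -natrX -!natrM ler_nat.
have : (2 ^ rounds s <= s.+1)%N by apply: trunc_logP.
lia.
Qed.

Lemma exists_dyadic_scale (R : realType) m (dl : R) : 0 < dl ->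
  exists K, 3 * m%:R * (2 ^+ K)^-1 <= dl.
Proof.
move=> d0; pose a := 3 * m%:R / dl; have a0 : 0 <= a by rewrite divr_ge0 ?mulr_ge0 // ltW.
exists (Num.truncn a); have /andP[_ lt] := truncn_itv a0.
rewrite ler_pdivrMr ?exprn_gt0 // [leRHS]mulrC -ler_pdivrMr //.
apply: le_trans (ltW lt) _; rewrite -natrX ler_nat.
exact: ltn_expl.
Qed.

Lemma exists_roundable (R : realType) (nA m : nat) (A : 'M[R]_(nA, m))
    (Delta : 'I_nA -> R) (nB : nat) (B : 'I_nB.+1 -> 'I_m -> R) (mu : 'I_nB.+1 -> R)
    (x : 'I_m -> R) :
  (0 < m)%N -> (forall i, 0 < Delta i) ->
  (forall J : {set 'I_m},
     approx_entropy Delta (col_submx A J) <= #|J|%:R / 10) ->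
  (forall i j, `|B i j| <= 1) -> (forall i, 0 < mu i <= 1) -> \sum_i mu i <= 2 ->
  (forall j, 0 <= x j <= 1) ->
  exists (z : 'I_m -> R) (L : R),
  [/\ forall i, dot (A i) z = dot (A i) x, forall i, dot (B i) z = dot (B i) x,
    (0 < nA)%N -> L <= log2 (minn (4 * (nA + nB)) (4 * m))%:R &
    roundable (fun i => A i) Delta B z L L
      (fun i => (25 / 4 * scale R + 1) / Num.sqrt (mu i))].
Proof.
move=> m0 D0 HA HB mu01 mu2 x01.
have mu0 i : 0 < mu i by have /andP[] := mu01 i.
pose M (i : 'I_(nA + nB.+1)) :=
  match fintype.split i with inl k => A k | inr k => B k end.
have [z [z01 zM zF]] := few_fractional M x01.
have zA i : dot (A i) z = dot (A i) x.
  by have := zM (unsplit (inl i)); rewrite /M unsplitK.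
have zB i : dot (B i) z = dot (B i) x.
  by have := zM (unsplit (inr i)); rewrite /M unsplitK.
(* The initial rounding may use the slack of [rounds_log2] for [A], and at most 1 for the rows of
   [B]. *)
pose dl : R := Num.min 1 ((ln 4 - ln 3) / ln 2).
have dl0 : 0 < dl.
  by rewrite lt_min ltr01 /= divr_gt0 ?ln2_gt0 // subr_gt0 ltr_ln ?posrE // ltr_nat.
have [K Kle] := exists_dyadic_scale m dl0.
have m0R : 0 <= m%:R :> R by [].
have p0 : 0 <= (2 ^+ K)^-1 :> R by rewrite invr_ge0 exprn_ge0.
have mp0 := mulr_ge0 m0R p0.
have p4 : (4 ^+ K)^-1 <= (2 ^+ K)^-1 :> R.
  by rewrite lef_pV2 ?posrE ?exprn_gt0 // lerXn2r ?nnegrE // ler_nat.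
have mp4 := ler_wpM2l m0R p4.
have [dl1 dl2] : dl <= 1 /\ dl <= (ln 4 - ln 3) / ln 2.
  by rewrite /dl !ge_min !lexx orbT.
exists z, ((rounds #|fractional z|)%:R + dl); split=> // [nA0|].
  apply: le_trans (_ : (rounds #|fractional z|)%:R + (ln 4 - ln 3) / ln 2 <= _).
    by rewrite lerD2l.
  apply: rounds_log2 => //; first by rewrite addn_gt0 nA0.
    by rewrite -[leqRHS]card_ord max_card.
  by rewrite -addnS.
have zS j : j \notin fractional z -> z j = 0 \/ z j = 1.
  by rewrite inE negb_and !negbK => /orP[]/eqP; [left|right].
have zd (j : 'I_m) : (m <= j)%N -> exists u : nat, z j = u%:R / 2 ^+ K.
  by move=> mj; have := ltn_ord j; rewrite ltnNge mj.
have rd := roundable_dyadic D0 (fun i => budget_ge0 (mu i) 0)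
  (fun i s => budget_le (mu i) s) (exists_coloring D0 HA HB mu0 mu2)
  (entry_le D0 HA HB mu0 mu2) HB z01 zS zd.
apply: (roundable_le D0) rd.
- by rewrite lerD2l; lra.
- by rewrite lerD2l; lra.
move=> i; rewrite [leRHS]mulrDl lerD2l.
apply: le_trans (_ : 1 <= _); first by lra.
rewrite ler_pdivlMr ?sqrtr_gt0 // mul1r -[leRHS]sqrtr1 ler_wsqrtr //.
by have /andP[] := mu01 i.
Qed.

Lemma sum_unlift0 (R : realType) nB (mu : 'I_nB -> R) :
  \sum_(i < nB.+1) (if unlift ord0 i is Some k then mu k else 1) =
  1 + \sum_k mu k.
Proof.
rewrite big_ord_recl unlift_none; congr (_ + _).
by apply: eq_bigr => k _; rewrite liftK.
Qed.

Theorem theorem6 (R : realType) :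
  exists2 C : R, 0 < C &
  forall (nA nB m : nat) (A : 'M[R]_(nA, m)) (Delta : 'I_nA -> R)
    (B : 'M[R]_(nB, m)) (mu : 'I_nB -> R) (x c : 'cV[R]_m),
  (0 < m)%N ->
  (forall i, 0 < Delta i) ->
  (forall J : {set 'I_m},
     approx_entropy Delta (col_submx A J) <= #|J|%:R / 10) ->
  (forall i j, -1 <= B i j <= 1) ->
  (forall i, 0 < mu i) ->
  \sum_i mu i <= 1 ->
  (forall j, 0 <= x j 0 <= 1) ->
  (forall j, -1 <= c j 0 <= 1) ->
  let n := (nA + nB)%N in
  let L : R := log2 (minn (4 * n) (4 * m))%:R in
  exists (d : measure_display) (Omega : measurableType d)
    (P : probability Omega R) (Y : 'I_m -> {RV P >-> bool}),
  let y (w : Omega) : 'cV[R]_m := bool_vec R (fun j => Y j w) in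
  [/\ [/\ ('E_P[fun w => ((c^T *m y w) 0 0)%R] = ((c^T *m x) 0 0)%:E)%E,
          forall i, ('E_P[fun w => ((A *m y w) i 0)%R] = ((A *m x) i 0)%:E)%E &
          forall i, ('E_P[fun w => ((B *m y w) i 0)%R] = ((B *m x) i 0)%:E)%E],
      [/\ forall w, `|(c^T *m x) 0 0 - (c^T *m y w) 0 0| <= C,
          forall i w, `|(A *m x) i 0 - (A *m y w) i 0| <= L * Delta i &
          forall i w, `|(B *m x) i 0 - (B *m y w) i 0|
                        <= C * Num.sqrt (1 / mu i)] &
      forall (i : 'I_nA) (lambda : R), 0 <= lambda ->
        (P [set w | lambda * Num.sqrt L * Delta i
                      <= `|(A *m x) i 0 - (A *m y w) i 0|]%R
           <= (2 * expR (- (lambda ^+ 2 / 2)))%:E)%E].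
Proof.
have C0 := scale_gt0 R.
exists (25 / 4 * scale R + 1); first by lra.
move=> nA nB m A Delta B mu x c m0 D0 HA B1 mu0 mu1 x01 c1 n L.
(* The objective becomes row 0 of [B'] with weight 1, which makes its deviation O(1) and the total
   weight at most 2. *)
pose B' (i : 'I_nB.+1) (j : 'I_m) := if unlift ord0 i is Some k then B k j else c j 0.
pose mu' (i : 'I_nB.+1) := if unlift ord0 i is Some k then mu k else 1.
have mu_le1 k : mu k <= 1.
  apply: le_trans mu1; rewrite (bigD1 k) //= lerDl sumr_ge0 // => i _.
  exact: ltW.
have B'1 i j : `|B' i j| <= 1.
  by rewrite /B' ler_norml; case: (unlift _ _).
have mu'1 i : 0 < mu' i <= 1.
  by rewrite /mu'; case: (unlift _ _) => [k|]; rewrite ?mu0 ?mu_le1 ?ltr01 ?lexx.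
have mu'2 : \sum_i mu' i <= 2 by rewrite sum_unlift0; lra.
have [z [L' [zA zB L'L]]] := exists_roundable m0 D0 HA B'1 mu'1 mu'2 x01.
move=> [p [p0 p1 pz [pA pB pE]]].
have [d [W [P [Y [Ypos YE YP]]]]] := finite_realization p0 p1.
exists d, W, P, Y => y.
pose zz w := [ffun j => Y j w].
have mx_dot k (M : 'M[R]_(k, m)) i (v : 'cV[R]_m) : (M *m v) i 0 = dot (M i) (fun j => v j 0).
  by rewrite mxE.
have yE a w : dot a (fun j => y w j 0) = dot a (fun j => (zz w j)%:R).
  by apply: eq_dot => j; rewrite mxE ffunE.
have subE a w : dot a z = dot a (fun j => x j 0) ->
    `|dot a (fun j => x j 0) - dot a (fun j => y w j 0)| = `|dot a (diff (zz w) z)|.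
  move=> <-; rewrite yE distrC; congr (`| _ |).
  rewrite (@eq_dot _ _ a (diff (zz w) z) (fun j => (zz w j)%:R + -1 * z j)); last first.
    by move=> j; rewrite /diff mulN1r.
  by rewrite dotD dotZ mulN1r.
have mean a : dot a z = dot a (fun j => x j 0) ->
    ('E_P[fun w => dot a (fun j => y w j 0)%R] = (dot a (fun j => x j 0)%R)%:E)%E.
  move=> <-.
  pose F (v : {ffun 'I_m -> bool}) := dot a (fun j => (v j)%:R).
  rewrite (_ : (fun w => _) = (fun w => F [ffun j => Y j w])); last first.
    by apply/funext => w; rewrite yE.
  rewrite YE; congr (_%:E); rewrite /F /dot.
  under eq_bigr do rewrite mulr_sumr.
  rewrite exchange_big; apply: eq_bigr => j _.
  by rewrite -pz mulr_sumr; apply: eq_bigr => v _; rewrite mulrCA.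
have cE : B' ord0 = c^T 0.
  by apply/funext => j; rewrite /B' unlift_none mxE.
have BE i : B' (lift ord0 i) = B i by apply/funext => j; rewrite /B' liftK.
have zc : dot (c^T 0) z = dot (c^T 0) (fun j => x j 0).
  by have := zB ord0; rewrite cE.
have zBi i : dot (B i) z = dot (B i) (fun j => x j 0).
  by have := zB (lift ord0 i); rewrite BE.
split; [split|split|].
- by under eq_fun do rewrite mx_dot; rewrite mean // mx_dot.
- by move=> i; under eq_fun do rewrite mx_dot; rewrite mean ?mx_dot // zA.
- by move=> i; under eq_fun do rewrite mx_dot; rewrite mean ?mx_dot // zBi.
- move=> w; rewrite !mx_dot subE //.
  have := pB (zz w) ord0 (Ypos w).
  by rewrite cE /mu' unlift_none sqrtr1 divr1.
- move=> i w; rewrite !mx_dot subE ?zA //.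
  apply: le_trans (pA _ i (Ypos w)) _; rewrite ler_pM2r //.
  by apply: L'L; have := ltn_ord i; lia.
- move=> i w; rewrite !mx_dot subE ?zBi //.
  have := pB (zz w) (lift ord0 i) (Ypos w).
  by rewrite BE /mu' liftK div1r sqrtrV // ltW.
move=> i lambda l0.
have nA0 : (0 < nA)%N by have := ltn_ord i; lia.
have LL := L'L nA0; rewrite -/n -/L in LL.
have L0 : 0 < L.
  rewrite divr_gt0 ?ln2_gt0 // ln_gt0 // ltr1n; lia.
have V0 : 0 < Num.sqrt L * Delta i by rewrite mulr_gt0 ?sqrtr_gt0.
have := @mgf_tail R _ p (fun v => dot (A i) (diff v z)) _ lambda p0 V0 l0.
rewrite -lee_fin -YP mulrA.
rewrite (_ : [set w | _] = [set w | lambda * Num.sqrt L * Delta i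
    <= `|(A *m x) i 0 - (A *m y w) i 0|]); last first.
  by apply/funext => w /=; rewrite !mx_dot subE ?zA.
apply=> th; apply: le_trans (pE i th) _; rewrite ler_expR ler_pM2r //.
rewrite [(_ * Delta i) ^+ 2]exprMn sqr_sqrtr ?(ltW L0) // [leRHS]mulrA.
by apply: ler_wpM2r (sqr_ge0 _) _ _ _; apply: ler_wpM2l (sqr_ge0 _) _ _ LL.
Qed.
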